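(* (1) For any polynomial $p_0^N$ of degree $N$, with heat evolution $p_\tau^N$, the moments $M_{a,N}(\tau)=\frac1N\sum_{j=1}^N(z_{j,N}(\tau))^a$, where $\{z_{j,N}(\tau)\}_{j=1}^N$ are the roots of $p_\tau^N$, satisfy $$\frac{dM_{0,N}}{d\tau}=\frac{dM_{1,N}}{d\tau}=0,$$ and for $a\ge2$, $$\frac{dM_{a,N}}{d\tau}=\frac1{2N}a(a-1)M_{a-2,N}(\tau)-\frac a2\sum_{b=0}^{a-2}M_{b,N}(\tau)M_{a-b-2,N}(\tau).$$ (2) Suppose now that $p_0^N$ is a sequence of polynomials of degree $N$ such that the limit $M_a(0):=\lim_{N\to\infty}M_{a,N}(0)$ exists for all $a$. Then the limit $M_a(\tau):=\lim_{N\to\infty}M_{a,N}(\tau)$ exists for all $\tau$, and these limiting moments satisfy the limiting version of the equations in (1), namely $$\frac{dM_a}{d\tau}=-\frac a2\sum_{b=0}^{a-2}M_b(\tau)M_{a-b-2}(\tau)$$ (the sum being empty, and the right-hand side zero, for $a=0,1$). (3) Suppose $\mu_\tau$ is a family of compactly supported probability measures on $\mathbb{C}$ whose log potential $S(z,\tau)$ satisfies the PDE $$\frac{\partial S}{\partial\tau}=\frac12\left(\frac{\partial S}{\partial z}\right)^2$$ for $z$ near infinity and $\tau$ in some open set $U\subset\mathbb{C}$. Let $\hat M_a(\tau)=\int_{\mathbb{C}}z^a\,d\mu_\tau(z)$ be the $a$-th holomorphic moment of $\mu_\tau$. Then these moments also satisfy the equation in (2): $$\frac{d\hat M_a}{d\tau}=-\frac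 a2\sum_{b=0}^{a-2}\hat M_b(\tau)\hat M_{a-b-2}(\tau)$$ for $\tau\in U$ (again with an empty sum for $a=0,1$).
   Context: The heat evolution of a polynomial $p_0^N$ of degree $N$ is $p_\tau^N(z)=\exp\left(\frac{\tau}{2N}\frac{d^2}{dz^2}\right)p_0^N(z)=\sum_{k\ge0}\frac1{k!}\left(\frac\tau{2N}\right)^k\left(\frac{d^2}{dz^2}\right)^kp_0^N(z)$ for $\tau\in\mathbb{C}$ (a terminating sum); it again has degree $N$, and its roots are listed with multiplicity. The index $a$ ranges over $0,1,2,\dots$. The log potential of a compactly supported probability measure $\mu$ on $\mathbb{C}$ is $S(z)=\int_{\mathbb{C}}\log(|z-w|^2)\,d\mu(w)$; $S(z,\tau)$ denotes the log potential of $\mu_\tau$. In the PDE, $\partial/\partial\tau=\frac12(\partial_{\tau_1}-i\partial_{\tau_2})$ and $\partial/\partial z=\frac12(\partial_x-i\partial_y)$ are the Cauchy–Riemann operators, with $\tau=\tau_1+i\tau_2$ and $z=x+iy$. *)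

(* Defs.v *)
From HB Require Import structures.
From mathcomp Require Import all_boot all_order all_algebra.
From mathcomp Require Import all_classical all_reals all_analysis.
From mathcomp Require Import complex.

Set Implicit Arguments.
Unset Strict Implicit.
Unset Printing Implicit Defensive.

Import Order.TTheory GRing.Theory Num.Theory.
Import numFieldNormedType.Exports.

Local Open Scope classical_set_scope.
Local Open Scope complex_scope.
Local Open Scope ring_scope.

(* R[i] gets its topology and its structure of normed space over itself by
   being seen as a numClosedFieldType; in particular, for f : Cplx R -> Cplx R,
   [is_derive t 1 f d] says that d is the complex derivative of f at t. *)
Definition Cplx (R : realType) : numClosedFieldType := R[i].

Section Polynomials.
Context {R : realType}.
Local Notation C := (Cplx R).

(* The terms of index k >= size p of the exponential series vanish. *)
Definition heat (N : nat) (tau : C) (p : {poly C}) : {poly C} :=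
  \sum_(k < size p)
    ((k`!)%:R^-1 * (tau / (2%:R * N%:R)) ^+ k) *: derivn (2 * k) p.

(* The roots of p with multiplicity, in an unspecified order: for p != 0,
   p = lead_coef p *: \prod_(z <- root_list p) ('X - z%:P). *)
Definition root_list (p : {poly C}) : seq C :=
  sval (closed_field_poly_normal p).

Definition root_moment (p : {poly C}) (N a : nat) (tau : C) : C :=
  N%:R^-1 * \sum_(z <- root_list (heat N tau p)) z ^+ a.

Definition limit_root_moment (p : nat -> {poly C}) (a : nat) (tau : C) : C :=
  limn (fun N => root_moment (p N) N a tau).

End Polynomials.

Section Measures.
Context {R : realType}.
Local Notation C := (Cplx R).

Definition Cborel : measurableType _ :=
  g_sigma_algebraType (open : set (set C)).

Definition compactly_supported (mu : probability Cborel R) : Prop :=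
  exists K : set C, compact K /\ mu (~` K) = 0%E.

Definition holo_moment (mu : probability Cborel R) (a : nat) : C :=
  (\int[mu]_w complex.Re ((w : C) ^+ a)) +i*
  (\int[mu]_w complex.Im ((w : C) ^+ a)).

(* Since [lne 0 = -oo], the potential may take the value -oo. *)
Definition log_potential (mu : probability Cborel R) (z : C) : \bar R :=
  (\int[mu]_w lne ((Normc.normc (z - (w : C)) ^+ 2)%:E))%E.

(* (z, tau) |-> S(z, tau) in the real coordinates ((x, y), (tau_1, tau_2)) *)
Definition potential_coord (mu : C -> probability Cborel R)
    (q : (R * R) * (R * R)) : R :=
  fine (log_potential (mu (q.2.1 +i* q.2.2)) (q.1.1 +i* q.1.2)).

(* 1/2 (d/dx - i d/dy) *)
Definition wirtinger_z (F : (R * R) * (R * R) -> R) (q : (R * R) * (R * R)) : C :=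
  (2%:R^-1 : C) * ('D_((1, 0), (0, 0)) F q -i* 'D_((0, 1), (0, 0)) F q : C).

(* 1/2 (d/dtau_1 - i d/dtau_2) *)
Definition wirtinger_tau (F : (R * R) * (R * R) -> R) (q : (R * R) * (R * R)) : C :=
  (2%:R^-1 : C) * ('D_((0, 0), (1, 0)) F q -i* 'D_((0, 0), (0, 1)) F q : C).

(* The equation dS/dtau = 1/2 (dS/dz)^2 holds classically at (z, tau).
   Finiteness is required at the point because [potential_coord] sends -oo
   to 0; differentiability is required because 'D_v is total. *)
Definition potential_pde (mu : C -> probability Cborel R) (z tau : C) : Prop :=
  let S := potential_coord mu in
  let q := ((complex.Re z, complex.Im z), (complex.Re tau, complex.Im tau)) in
  [/\ log_potential (mu tau) z \is a fin_num,
      differentiable S q &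
      wirtinger_tau S q = 2%:R^-1 * wirtinger_z S q ^+ 2].

End Measures.

Arguments Cborel R : clear implicits.

(* Main.v *)
Require Import Defs.
From HB Require Import structures.
From mathcomp Require Import all_boot all_order all_algebra.
From mathcomp Require Import all_classical all_reals all_analysis.
From mathcomp Require Import complex.
From mathcomp Require Import measurable_realfun.
From mathcomp Require Import ring lra.
Import Order.TTheory GRing.Theory Num.Theory.
Import numFieldNormedType.Exports.
Local Open Scope classical_set_scope.
Local Open Scope ring_scope.

(** The moments of the roots evolve by algebra. Let [Q] be the product of the
    [1 - z_j X] over the roots, which is the reversed monic polynomial, and let
    [P] be the generating series of the power sums of the roots. With the Euler
    operator [theta = X d/dX], Newton's identities say
    [(N - theta) Q = P Q] ([newton_identity]). The heat equation, read on the
    reversed polynomial, is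
    [dQ/dtau = kappa X^2 (N - theta) (N - 1 - theta) Q] with
    [kappa = 1 / (2 N)], and two applications of Newton's identities turn the
    right-hand side into [G Q] with [G = kappa X^2 (P^2 - P - theta P)].
    Differentiating [(N - theta) Q = P Q] in [tau] then leaves
    [dP/dtau = - theta G] ([deriv_newton]), whose coefficients are the moment
    equations.

    Since the coefficients of the heat evolution are polynomials in [tau] and
    the leading one is constant, every moment is itself a polynomial in [tau]
    ([root_moment_poly]). The equation for [M_a] involves only moments of order
    at most [a - 2], so induction on [a] gives convergence of the coefficients
    of these polynomials from convergence at [tau = 0], and the degrees stay
    bounded ([polycvg_deriv], [root_moment_limit]).

    For the measures, nothing controls the supports locally uniformly in [tau],
    and [S] is only known to be differentiable, so the expansion of [S] at
    infinity cannot be differentiated in [tau] term by term. Instead, fix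
    [tau0], let [m_a] be the polynomials that solve the moment hierarchy from
    the moments of [mu tau0] ([moment_flow_exists]), and let the profile be the
    expansion of a log potential at infinity with the moments [m_a (s h)],
    truncated at an odd order [n = 2 k + 1]. It solves the PDE along the
    segment [tau0 + s h] up to [O(|z|^(-2k-2))] ([profile_residual]). Along
    this segment [S] satisfies the scalar equation [dS/ds = Re (h p^2)] with
    [p = dS/dz], hence it obeys a maximum principle: it stays below any strict
    supersolution that dominates it initially and on the boundary
    ([comparison]). For small [h], adding
    [(1 + s) (A |z|^(-2k-2) + delta |z|^2)] to the profile produces such a
    supersolution ([barrier_supersolution]). It dominates [S] at [s = 0] by the
    expansion of [S] at [tau0], on an inner circle because [A] is large, and
    on a distant circle because of the term [delta |z|^2]. As [delta] tends to
    [0], this bounds [S] at [tau0 + h] by the profile plus [O(|z|^(-2k-2))]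
    ([flow_upper_bound]). But [S] has its own expansion there
    ([log_potential_expansion]), so the real part of a polynomial of degree
    [n] in [1/z] without constant term is at most [O(|z|^(-n-1))]. This forces
    the polynomial to vanish, because the real part of its leading term takes
    both signs ([expansion_coef_eq0]). Thus the moments of [mu (tau0 + h)] are
    exactly [m_a h] for small [h] ([moment_flow_local]), and their derivative
    is that of [m_a].

    The bounds on the two circles must be uniform in [tau]. They come from
    [S <= K + 2 |z|] ([potential_growth]): a log potential grows at most like
    [ln |z|^2] beyond its value at a real point near which the measure does not
    concentrate ([log_potential_growth]). Every unit interval contains such a
    point, on average over the interval ([exists_not_concentrated]), and [S] is
    bounded on a compact interval for [tau] near [tau0]. *)

Set Implicit Arguments.
Unset Strict Implicit.
Unset Printing Implicit Defensive.

(** * Newton's identities and the Euler operator *)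

(** Defines a sequence by course-of-values recursion; locality of [F] replaces
    a truncated argument. *)
Lemma course_of_values (T : Type) (x0 : T) (F : nat -> (nat -> T) -> T) :
  (forall n u v, (forall i, (i < n)%N -> u i = v i) -> F n u = F n v) ->
  exists u, forall n, u n = F n u.
Proof.
move=> Floc.
pose L := fix L n := if n is m.+1 then rcons (L m) (F m (nth x0 (L m))) else [::].
have sL n : size (L n) = n by elim: n => //= n IH; rewrite size_rcons IH.
have nL n m i : (i < n)%N -> (n <= m)%N -> nth x0 (L m) i = nth x0 (L n) i.
  move=> ltin; elim: m => [|m IH]; first by rewrite leqn0 => /eqP n0; rewrite n0 in ltin.
  rewrite leq_eqVlt => /orP[/eqP -> //|lenm].
  by rewrite /= nth_rcons sL (leq_trans ltin lenm) IH.
exists (fun n => nth x0 (L n.+1) n) => n.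
rewrite /= nth_rcons sL ltnn eqxx.
by apply: Floc => i ltin; rewrite (nL i.+1 n).
Qed.

Section EulerOperator.
Variable A : comNzRingType.
Implicit Types p q r : {poly A}.

Definition theta p := 'X * p^`().

Lemma coef_theta p i : (theta p)`_i = i%:R * p`_i.
Proof.
rewrite /theta coefXM; case: i => [|i] /=; first by rewrite mul0r.
by rewrite coef_deriv mulr_natl.
Qed.

Lemma coef_natrM (m : nat) p i : (m%:R * p)`_i = m%:R * p`_i.
Proof. by rewrite !mulr_natl coefMn. Qed.

(** Identities between power series are used modulo [X^K], which keeps them
    inside polynomials. *)
Definition Xdvd K p := exists r, p = 'X^K * r.

Lemma XdvdP K p : (forall i, (i < K)%N -> p`_i = 0) <-> Xdvd K p.
Proof.
split=> [p0|[r ->] i ltiK]; last by rewrite coefXnM ltiK.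
exists (drop_poly K p); rewrite -[LHS](poly_take_drop K) mulrC.
suff -> : take_poly K p = 0 by rewrite add0r.
by apply/polyP=> i; rewrite coef_take_poly coef0; case: ifP => // /p0.
Qed.

Lemma XdvdD K p q : Xdvd K p -> Xdvd K q -> Xdvd K (p + q).
Proof. by move=> [r ->] [s ->]; exists (r + s); rewrite mulrDr. Qed.

Lemma XdvdMl K p q : Xdvd K q -> Xdvd K (p * q).
Proof. by move=> [s ->]; exists (p * s); rewrite mulrCA. Qed.

Lemma XdvdN K p : Xdvd K p -> Xdvd K (- p).
Proof. by rewrite -mulN1r; apply: XdvdMl. Qed.

Lemma XdvdB K p q : Xdvd K p -> Xdvd K q -> Xdvd K (p - q).
Proof. by move=> dp dq; apply: XdvdD => //; apply: XdvdN. Qed.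

Lemma Xdvd_theta K p : Xdvd K p -> Xdvd K (theta p).
Proof.
by move/XdvdP=> p0; apply/XdvdP => i ltiK; rewrite coef_theta p0 ?mulr0.
Qed.

(** The coefficients of [p * q] are triangular in those of [p], with [q`_0] on
    the diagonal. *)
Lemma Xdvd_cancel K p q : GRing.lreg q`_0 -> Xdvd K (p * q) -> Xdvd K p.
Proof.
move=> q0 /XdvdP pq0; apply/XdvdP; elim/ltn_ind=> i IH ltiK.
have := pq0 _ ltiK; rewrite coefM big_ord_recr /= subnn big1 ?add0r.
  by rewrite mulrC => e; apply: q0; rewrite e mulr0.
by move=> j _; rewrite IH ?mul0r // (ltn_trans _ ltiK).
Qed.

Lemma coef_polyM K (u v : nat -> A) n : (n < K)%N ->
  ((\poly_(i < K) u i) * (\poly_(i < K) v i))`_n = \sum_(i < n.+1) u i * v (n - i)%N.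
Proof.
move=> ltnK; rewrite coefM; apply: eq_bigr => i _; rewrite !coef_poly.
have ltiK : (i < K)%N by apply: leq_ltn_trans ltnK; rewrite -ltnS.
by rewrite ltiK (leq_ltn_trans (leq_subr _ _) ltnK).
Qed.

(** For a single root this is the geometric series
    [1 = (1 + z X + z^2 X^2 + ...) (1 - z X)]. Since [theta] is a derivation, the
    identity passes to products: the products [Q] multiply while the numbers of
    roots and the series of power sums add. *)
Lemma newton_mod K (s : seq A) :
  Xdvd K ((size s)%:R * \prod_(z <- s) (1 - z%:P * 'X)
          - theta (\prod_(z <- s) (1 - z%:P * 'X))
          - (\poly_(a < K) \sum_(z <- s) z ^+ a) * \prod_(z <- s) (1 - z%:P * 'X)).
Proof.
elim: s => [|z s IH].
  have -> : \poly_(a < K) (\sum_(z <- [::] : seq A) z ^+ a) = 0.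
    by apply/polyP=> i; rewrite coef_poly big_nil coef0 if_same.
  by exists 0; rewrite big_nil /theta -[1]polyC1 derivC /= !mulr0 mul0r !subr0.
rewrite !big_cons /=; set Q := \prod_(y <- s) _ in IH *.
have -> : \poly_(a < K) (\sum_(y <- z :: s) y ^+ a)
        = \poly_(a < K) (z ^+ a) + \poly_(a < K) \sum_(y <- s) y ^+ a.
  by apply/polyP=> i; rewrite coefD !coef_poly big_cons; case: ifP; rewrite ?addr0.
set P := \poly_(a < K) (\sum_(y <- s) _) in IH *.
have geom : Xdvd K (1 - (\poly_(a < K) (z ^+ a)) * (1 - z%:P * 'X)).
  apply/XdvdP => i ltiK; rewrite mulrBr mulr1 mulrA coefB coefB coefMX coef1 coefMC !coef_poly ltiK.
  by case: i ltiK => [|i] lti /=; rewrite ?subr0 ?subrr // (ltn_trans _ lti) // -exprSr subrr subr0.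
(* Leibniz' rule: the identity for s times the new factor, plus Q times geom. *)
move: (XdvdD (XdvdMl (1 - z%:P * 'X) IH) (XdvdMl Q geom)).
congr Xdvd; rewrite /theta -[1 - _]/(1%:P - z%:P * 'X).
rewrite !(derivM, derivB, derivX, derivC) -natr1; ring.
Qed.

Lemma coef_prod_rev (s : seq A) n :
  (\prod_(z <- s) (1 - z%:P * 'X))`_n =
  if (n <= size s)%N then (\prod_(z <- s) ('X - z%:P))`_(size s - n) else 0.
Proof.
elim: s n => [|z s IH] n; first by rewrite !big_nil !coef1 /=; case: n.
rewrite !big_cons mulrBl mul1r coefB -mulrA coefCM coefXM !IH mulrBl coefB coefXM coefCM /=.
have big0 k : (size s < k)%N -> (\prod_(z <- s) ('X - z%:P))`_k = 0.
  by move=> ltk; rewrite nth_default // size_prod_XsubC.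
case: n => [|n] /=.
  by rewrite !subn0 (big0 _ (ltnSn _)) mulr0.
rewrite ltnS subSS; case: (ltngtP n (size s)) => [lt|gt|->].
- by rewrite -subn_gt0 in lt; rewrite subnS; case: (size s - n)%N lt.
- by rewrite mulr0 subr0.
- by rewrite subnn.
Qed.

Lemma newton_identity (s : seq A) n :
  ((size s)%:R - n%:R) * (\prod_(z <- s) (1 - z%:P * 'X))`_n =
  \sum_(a < n.+1) (\sum_(z <- s) z ^+ a) * (\prod_(z <- s) (1 - z%:P * 'X))`_(n - a).
Proof.
have /XdvdP /(_ n (ltnSn n)) := newton_mod n.+1 s.
set Q := \prod_(z <- s) _.
rewrite !coefB coef_theta coef_natrM -mulrBl => /eqP; rewrite subr_eq0 => /eqP ->.
rewrite coefM; apply: eq_bigr => i _; by rewrite coef_poly ltn_ord.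
Qed.

End EulerOperator.

(** * The moment equations for a polynomial under the heat flow *)
Section HeatNewton.
Variables (A : comNzRingType) (d : {additive A -> A}).
Hypothesis dM : forall x y, d (x * y) = d x * y + x * d y.
Variables (N : nat) (kappa : A) (q P : nat -> A).
Hypothesis q0 : GRing.lreg (q 0).
Hypothesis newton : forall n,
  (N%:R - n%:R) * q n = \sum_(a < n.+1) P a * q (n - a)%N.
Hypothesis dq0 : d (q 0) = 0.
Hypothesis dq1 : d (q 1) = 0.
Hypothesis dq2 : forall n,
  d (q n.+2) = kappa * ((N%:R - n%:R) * (N%:R - n%:R - 1) * q n).

(** [q] lists the coefficients of the reversed polynomial and [d] is the
    derivation in time. As series, [newton] reads [(N - theta) Q = P Q] and
    [dq0], [dq1], [dq2] read [dQ = kappa X^2 (N - theta) (N - 1 - theta) Q]; the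
    latter equals [G Q]. Applying [d] to the former and cancelling [Q] yields
    [dP = - theta G]. *)
Lemma deriv_newton n :
  d (P n) = - (n%:R * kappa *
    (if n is b.+2 then \sum_(i < b.+1) P i * P (b - i)%N - b.+1%:R * P b else 0)).
Proof.
pose K := n.+1.
pose Q := \poly_(i < K) q i; pose Qd := \poly_(i < K) d (q i).
pose p := \poly_(i < K) P i; pose pd := \poly_(i < K) d (P i).
pose G := kappa%:P * 'X^2 * (p ^+ 2 - p - theta p).
pose L (f : {poly A}) := N%:R%:P * f - theta f.
have dN m x : d (m%:R * x) = m%:R * d x by rewrite !mulr_natl raddfMn.
have coefL f i : (L f)`_i = (N%:R - i%:R) * f`_i.
  by rewrite /L coefB coef_theta coefCM mulrBl.
have dL f : Xdvd K f -> Xdvd K (L f).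
  by move=> df; apply: XdvdB; [apply: XdvdMl | apply: Xdvd_theta].
(* a1, a2, a3 are the defects of Newton's identities, of their derivative and
   of the heat equation, and a4 that of Qd = G Q: all vanish modulo X^K. *)
pose a1 := L Q - p * Q.
pose a2 := L Qd - pd * Q - p * Qd.
pose a3 := Qd - kappa%:P * 'X^2 * (L (L Q) - L Q).
have D1 : Xdvd K a1.
  apply/XdvdP=> i ltiK; rewrite coefB coefL coef_polyM // coef_poly ltiK newton.
  by rewrite subrr.
have D2 : Xdvd K a2.
  apply/XdvdP=> i ltiK; rewrite 2!coefB coefL !coef_polyM // coef_poly ltiK.
  have := congr1 d (newton i); rewrite raddf_sum.
  under eq_bigr do rewrite dM.
  rewrite big_split /= mulrBl raddfB /= !dN -mulrBl => ->.
  by rewrite -addrA -opprD subrr.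
have D3 : Xdvd K a3.
  apply/XdvdP=> i ltiK; rewrite coefB -mulrA coefCM coefXnM !coef_poly ltiK.
  case: i ltiK => [|[|i]] ltiK /=; first by rewrite dq0 mulr0 subrr.
    by rewrite dq1 mulr0 subrr.
  have ltiK' : (i < K)%N by do 2 apply: ltnW.
  by rewrite subn2 /= coefB !coefL coef_poly ltiK' dq2; ring.
pose a4 := a3 + kappa%:P * 'X^2 * (L a1 + p * a1 - a1).
have D4 : Xdvd K a4.
  apply: XdvdD => //; apply: XdvdMl; apply: XdvdB => //; apply: XdvdD; first exact: dL.
  exact: XdvdMl.
have e4 : Qd = a4 + G * Q.
  rewrite /a4 /a3 /a1 /G /L /theta !(derivB, derivD, derivM, derivC, derivX) mul0r.
  move: (Qd) (Q) (p) => u v w.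
  by ring.
have D5 : Xdvd K ((pd + theta G) * Q).
  have -> : (pd + theta G) * Q = L a4 + G * a1 - p * a4 - a2.
    have -> : a2 = L (a4 + G * Q) - pd * Q - p * (a4 + G * Q) by rewrite -e4.
    rewrite /a1 /L /theta !(derivB, derivD, derivM, derivC) !mul0r.
    move: (a4) (pd) (Q) (p) (G) => u v w x y.
    by ring.
  apply: XdvdB => //; apply: XdvdB; last exact: XdvdMl.
  by apply: XdvdD; [apply: dL | apply: XdvdMl].
have /XdvdP /(_ n (ltnSn n)) : Xdvd K (pd + theta G).
  by apply: Xdvd_cancel D5; rewrite coef_poly.
rewrite coefD coef_poly ltnSn coef_theta => /eqP; rewrite addr_eq0 => /eqP ->.
rewrite -mulrA; congr (- (_ * _)).
rewrite /G -mulrA coefCM; congr (_ * _); rewrite coefXnM.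
have: (n < K)%N by []. move: (n) => [|[|b]] //= ltbK; rewrite subn2 /=.
rewrite !coefB expr2 coef_theta coef_polyM; last by do 2 apply: ltnW.
rewrite coef_poly ifT; last by do 2 apply: ltnW.
rewrite -natr1; ring.
Qed.
End HeatNewton.

(** Newton's identities are triangular in [P], with [q 0] on the diagonal. *)
Lemma newton_unique (A : comNzRingType) (q P P' : nat -> A) :
  GRing.lreg (q 0%N) ->
  (forall n, \sum_(a < n.+1) P a * q (n - a)%N = \sum_(a < n.+1) P' a * q (n - a)%N) ->
  P =1 P'.
Proof.
move=> q0 e n; elim/ltn_ind: n => n IH; have := e n.
rewrite !big_ord_recr /= subnn; under eq_bigr do rewrite IH //.
by move/addrI; rewrite [LHS]mulrC [RHS]mulrC => /q0.
Qed.

Lemma newton_exists (A : comUnitRingType) (N : nat) (q : nat -> A) :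
  q 0%N \is a GRing.unit ->
  exists P : nat -> A, forall n,
    (N%:R - n%:R) * q n = \sum_(a < n.+1) P a * q (n - a)%N.
Proof.
move=> q0.
have [|P PE] := @course_of_values A 0 (fun n P =>
  ((N%:R - n%:R) * q n - \sum_(a < n) P a * q (n - a)%N) / q 0%N).
  by move=> n u v uv; under eq_bigr do rewrite uv //.
by exists P => n; rewrite big_ord_recr /= subnn [P n]PE divrK // addrC subrK.
Qed.

Lemma is_derive_horner (F : numFieldType) (p : {poly F}) (x : F) :
  is_derive x 1 (horner p) p^`().[x].
Proof.
elim/poly_ind: p => [|p c IH].
  have -> : horner (0 : {poly F}) = cst 0 by apply/funext=> y; rewrite horner0.
  by rewrite deriv0 horner0; apply: is_derive_cst.
have -> : horner (p * 'X + c%:P) = horner p * id + cst c.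
  by apply/funext => y; rewrite !hornerE.
apply: is_derive_eq.
by rewrite derivD derivM derivX derivC !hornerE /= /GRing.scale /=; ring.
Qed.

Section HeatMoments.
Context {R : realType}.
Local Notation C := (Cplx R).

(** The coefficient of [z^j] in the heat evolution, as a polynomial in the time
    variable. *)
Definition heat_coef (N : nat) (p : {poly C}) (j : nat) : {poly C} :=
  \poly_(k < size p)
    ((k`!)%:R^-1 * (2%:R * N%:R)^-1 ^+ k * (derivn (2 * k) p)`_j).

Lemma horner_heat_coef N p j tau : (heat_coef N p j).[tau] = (heat N tau p)`_j.
Proof.
rewrite horner_poly coef_sum; apply: eq_bigr => k _.
rewrite coefZ expr_div_n exprVn; ring.
Qed.

Lemma coef_heat_coef N p j k : (heat_coef N p j)`_k =
  if (k < size p)%N then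
    (k`!)%:R^-1 * (2%:R * N%:R)^-1 ^+ k * (derivn (2 * k) p)`_j else 0.
Proof. by rewrite coef_poly. Qed.

(** The heat equation on coefficients: the second derivative in [z] moves the
    coefficient of index [j + 2] to index [j]. *)
Lemma deriv_heat_coef N p j :
  (heat_coef N p j)^`() =
  ((2%:R * N%:R)^-1 * (j.+2%:R * j.+1%:R)) *: heat_coef N p j.+2.
Proof.
apply/polyP=> k; rewrite coef_deriv coefZ !coef_heat_coef.
have step : (derivn (2 * k.+1) p)`_j = j.+2%:R * j.+1%:R * (derivn (2 * k) p)`_j.+2.
  by rewrite mulnS !derivnS !coef_deriv -mulrA !mulr_natl mulrnAC.
rewrite {}step factS natrM exprS.
have [kn|nk] := ltnP k.+1 (size p).
  rewrite (ltnW kn) -[LHS]mulr_natl invfM.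
  have k0 : k.+1%:R != 0 :> C by rewrite pnatr_eq0.
  move: (derivn _ _)`_j.+2 (2 * N%:R)^-1 (k`!%:R)^-1 => x c y.
  by field.
have [kn|//] := ltnP k (size p); last by rewrite mul0rn mulr0.
suff -> : (derivn (2 * k) p)`_j.+2 = 0 by rewrite !mulr0 mul0rn.
rewrite coef_derivn nth_default ?mul0rn // mul2n -addnn.
by apply: leq_trans nk _; rewrite -addnA -addn1 leq_add2l addnS.
Qed.

Lemma heat_coef_ge N (p : {poly C}) j : (size p <= j)%N -> heat_coef N p j = 0.
Proof.
move=> lepj; apply/polyP=> k; rewrite coef_heat_coef coef0; case: ifP => // _.
by rewrite coef_derivn nth_default ?mul0rn ?mulr0 // (leq_trans lepj) // leq_addl.
Qed.

Lemma heat_coef_lead N (p : {poly C}) n : size p = n.+1 -> heat_coef N p n = (lead_coef p)%:P.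
Proof.
move=> sp; apply/polyP=> -[|k]; rewrite coef_heat_coef coefC sp [RHS]/=.
  by rewrite muln0 derivn0 lead_coefE sp fact0 invr1 expr0 !mul1r.
case: ifP => // _; rewrite coef_derivn nth_default ?mul0rn ?mulr0 // sp mulnS.
by rewrite -addnA add2n ltnS -addSn leq_addl.
Qed.

Lemma size_heat N tau (p : {poly C}) n : size p = n.+1 -> size (heat N tau p) = n.+1.
Proof.
move=> sp; have lead : (heat N tau p)`_n != 0.
  rewrite -horner_heat_coef (heat_coef_lead _ sp) hornerC.
  by rewrite lead_coef_eq0 -size_poly_gt0 sp.
apply/eqP; rewrite eqn_leq; apply/andP; split; last first.
  by rewrite ltnNge; apply: contra lead => le; rewrite nth_default.
apply/leq_sizeP => j ltnj; rewrite -horner_heat_coef heat_coef_ge ?horner0 //.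
by rewrite sp.
Qed.

Lemma lead_coef_heat N tau (p : {poly C}) n :
  size p = n.+1 -> lead_coef (heat N tau p) = lead_coef p.
Proof.
move=> sp; rewrite lead_coefE (size_heat _ _ sp) /= -horner_heat_coef.
by rewrite (heat_coef_lead _ sp) hornerC.
Qed.

Lemma root_listP (p : {poly C}) :
  p = lead_coef p *: \prod_(z <- root_list p) ('X - z%:P).
Proof. by rewrite /root_list; case: closed_field_poly_normal. Qed.

Lemma size_root_list (p : {poly C}) : p != 0 -> (size (root_list p)).+1 = size p.
Proof.
move=> p0; rewrite [in RHS](root_listP p) size_scale ?lead_coef_eq0 //.
by rewrite size_prod_XsubC.
Qed.

(** Solving Newton's identities over the ring of polynomials in [tau] is
    possible because the leading coefficient of the heat evolution is a
    nonzero constant, hence a unit there; evaluation at [tau] recovers the power sums of the roots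
    by uniqueness. *)
Lemma root_moment_poly (N : nat) (p : {poly C}) : (0 < N)%N -> size p = N.+1 ->
  exists m : nat -> {poly C}, [/\ m 0%N = 1,
    forall a tau, root_moment p N a tau = (m a).[tau] &
    forall a, (m a)^`() =
      ((2%:R * N%:R)^-1 * a%:R * (a%:R - 1)) *: m (a - 2)%N
      - (a%:R / 2%:R) *: \sum_(0 <= b < a.-1) m b * m (a - b - 2)%N].
Proof.
move=> N0 sp.
have lp0 : lead_coef p != 0 by rewrite lead_coef_eq0 -size_poly_gt0 sp.
have nN0 : N%:R != 0 :> C by rewrite pnatr_eq0 -lt0n.
(* The reversed heat evolution; it agrees with lead_coef p times the product
   of the 1 - z X, and the common factor does not affect Newton's identities. *)
pose q n := if (n <= N)%N then heat_coef N p (N - n) else 0.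
have q0E : q 0%N = (lead_coef p)%:P by rewrite /q subn0 (heat_coef_lead _ sp).
have q0U : q 0%N \is a GRing.unit by rewrite q0E poly_unitE size_polyC coefC lp0 /= unitfE.
have [P newtonP] := newton_exists N q0U.
have sh tau : size (root_list (heat N tau p)) = N.
  apply: succn_inj; rewrite size_root_list ?(size_heat _ _ sp) //.
  by rewrite -size_poly_gt0 (size_heat _ _ sp).
have PE tau a : (P a).[tau] = \sum_(z <- root_list (heat N tau p)) z ^+ a.
  pose s := root_list (heat N tau p).
  have qE n : (q n).[tau] = lead_coef p * (\prod_(z <- s) (1 - z%:P * 'X))`_n.
    rewrite coef_prod_rev sh /q; case: ifP => _; last by rewrite horner0 mulr0.
    by rewrite horner_heat_coef {1}(root_listP (heat N tau p)) (lead_coef_heat _ _ sp) coefZ.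
  move: a; apply: (@newton_unique _ (fun n => (q n).[tau]) (fun a => (P a).[tau])
    (fun a => \sum_(z <- s) z ^+ a)) => [|n].
    by rewrite q0E hornerC; apply/lregP.
  have := congr1 (horner^~ tau) (newtonP n); rewrite horner_sum => /= e.
  transitivity ((N%:R - n%:R) * (q n).[tau]).
    rewrite hornerM in e; rewrite -[N%:R]polyC_natr -[n%:R]polyC_natr in e.
    by move: e; rewrite !hornerE => ->; apply: eq_bigr => i _; rewrite hornerM.
  rewrite qE mulrCA -{1}(sh tau) newton_identity mulr_sumr.
  by apply: eq_bigr => i _; rewrite qE mulrCA.
have dq2 n : (q n.+2)^`() = (2%:R * N%:R)^-1%:P *
    ((N%:R - n%:R) * (N%:R - n%:R - 1) * q n).
  rewrite /q; case: (ltnP n.+1 N) => [lt|].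
    have le : (n <= N)%N by do 2 apply: ltnW.
    have -> : (N - n = (N - n.+2).+2)%N by rewrite subnSK // subnSK // ltnW.
    rewrite le deriv_heat_coef -!natrB //.
    have -> : (N - n = (N - n.+2).+2)%N by rewrite subnSK // subnSK // ltnW.
    by rewrite -[X in _ * (_ * (X - 1) * _)]natr1 addrK -mul_polyC !polyCM !polyC_natr -!mulrA.
  rewrite leq_eqVlt => /orP[/eqP ->|].
    have e : n.+1%:R - n%:R = 1 :> {poly C} by rewrite -natr1 addrAC subrr add0r.
    by rewrite deriv0 e subrr mulr0 mul0r mulr0.
  rewrite ltnS => leNn; rewrite deriv0.
  move: leNn; rewrite leq_eqVlt => /orP[/eqP ->|]; first by rewrite subrr !mul0r mulr0.
  by rewrite ltnNge => /negbTE ->; rewrite !mulr0.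
have dq0 : (q 0%N)^`() = 0 by rewrite q0E derivC.
have dq1 : (q 1%N)^`() = 0.
  rewrite /q N0 deriv_heat_coef heat_coef_ge ?scaler0 // sp subn1 prednK //.
have dP := @deriv_newton _ (@deriv C) (@derivM C) N _ q P (mulrI q0U) newtonP dq0 dq1 dq2.
exists (fun a => N%:R^-1 *: P a); split.
- apply/eqP; have := newtonP 0%N.
  rewrite big_ord1 !subn0 subr0 => /(mulIr q0U) <-.
  by rewrite -polyC_natr -mul_polyC -polyCM mulVf.
- by move=> a tau; rewrite /root_moment hornerZ PE.
move=> a; rewrite derivZ dP; case: a => [|[|b]].
- by rewrite !(mulr0, mul0r, oppr0, scaler0, scale0r, subr0).
- by rewrite subrr big_nil !(mulr0, mul0r, oppr0, scaler0, scale0r, subr0).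
rewrite big_mkord subSS subSS subn0 /=.
have -> : \sum_(i < b.+1) (N%:R^-1 *: P i) * (N%:R^-1 *: P (b.+2 - i - 2)%N)
        = (N%:R^-1 ^+ 2) *: (\sum_(i < b.+1) P i * P (b - i)%N) :> {poly C}.
  rewrite scaler_sumr; apply: eq_bigr => i _.
  by rewrite subnAC subn2 /= -scalerAl -scalerAr scalerA.
set u := \sum_(i < b.+1) _; set v := P b.
rewrite invfM -!mul_polyC !(polyCM, polyCB, polyC_exp, polyC_natr).
ring.
Qed.
End HeatMoments.

(** * Limits of moments of roots *)

(** The right-hand side for [m a] involves only indices below [a], so the
    hierarchy is solved by successive antiderivatives. *)
Lemma moment_flow_exists (F : numFieldType) (M : nat -> F) :
  exists m : nat -> {poly F}, (forall a, (m a).[0] = M a) /\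
    forall a, (m a)^`() =
      - (a%:R / 2%:R) *: \sum_(0 <= b < a.-1) m b * m (a - b - 2)%N.
Proof.
pose prim (c : F) (p : {poly F}) := c%:P +
  'X * \poly_(i < size p) (p`_i / i.+1%:R).
have primE c p : (prim c p)^`() = p.
  apply/polyP=> i; rewrite coef_deriv coefD coefC /= add0r coefXM /= coef_poly.
  case: ltnP => [_|le]; last by rewrite mul0rn nth_default.
  by rewrite -[LHS]mulr_natr divfK // pnatr_eq0.
have [|m mE] := @course_of_values _ 0 (fun a m =>
  prim (M a) (- (a%:R / 2%:R) *: \sum_(0 <= b < a.-1) m b * m (a - b - 2)%N)).
  move=> a u v uv; congr prim; congr (_ *: _); apply: eq_big_nat => b /andP[_ ltb].
  case: a uv ltb => [|[|a]] // uv ltb; rewrite !uv //.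
    by rewrite subnAC subn2 ltnS (leq_trans (leq_subr _ _)).
  by rewrite (leq_trans ltb).
exists m; split=> a; rewrite mE ?primE //.
by rewrite hornerD hornerC hornerM hornerX mul0r addr0.
Qed.

Section PolyConvergence.
Variable F : numFieldType.
Implicit Types (u v : nat -> {poly F}) (L : {poly F}).

(** Convergence in a fixed finite-dimensional space of polynomials; for such
    sequences evaluation, products and antiderivatives are continuous. *)
Definition polycvg u L :=
  (exists d, forall N, (size (u N) <= d)%N) /\
  forall k, (fun N => (u N)`_k) @ \oo --> L`_k.

Lemma polycvg_horner u L x : polycvg u L -> (fun N => (u N).[x]) @ \oo --> L.[x].
Proof.
move=> [[d sd] uL].
have sL : (size L <= maxn d (size L))%N by rewrite leq_maxr.
have su N : (size (u N) <= maxn d (size L))%N by rewrite (leq_trans (sd N)) ?leq_maxl.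
rewrite (horner_coef_wide _ sL).
under eq_fun do rewrite (horner_coef_wide _ (su _)).
apply: cvg_big => [|i _]; first exact: add_continuous.
by apply: cvgM; [exact: uL | exact: cvg_cst].
Qed.

Lemma polycvgD u v L L' : polycvg u L -> polycvg v L' ->
  polycvg (fun N => u N + v N) (L + L').
Proof.
move=> [[d sd] uL] [[e se] vL]; split=> [|k].
  exists (maxn d e) => N; apply: leq_trans (size_polyD _ _) _.
  by rewrite geq_max !leq_max sd se orbT.
rewrite coefD; under eq_fun do rewrite coefD.
exact: cvgD.
Qed.

Lemma polycvgM u v L L' : polycvg u L -> polycvg v L' ->
  polycvg (fun N => u N * v N) (L * L').
Proof.
move=> [[d sd] uL] [[e se] vL]; split=> [|k].
  exists (d + e)%N => N; apply: leq_trans (size_polyMleq _ _) _.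
  by rewrite (leq_trans (leq_pred _)) // leq_add.
rewrite coefM; under eq_fun do rewrite coefM.
by apply: cvg_big => [|i _]; [exact: add_continuous | apply: cvgM].
Qed.

Lemma polycvgC (c : nat -> F) (l : F) : c @ \oo --> l ->
  polycvg (fun N => (c N)%:P) l%:P.
Proof.
move=> cl; split=> [|k]; first by exists 1%N => N; apply: size_polyC_leq1.
by rewrite coefC; under eq_fun do rewrite coefC; case: eqP => // _; apply: cvg_cst.
Qed.

Lemma polycvg_sum I (r : seq I) (u : I -> nat -> {poly F})
    (L : I -> {poly F}) :
  (forall i, polycvg (u i) (L i)) ->
  polycvg (fun N => \sum_(i <- r) u i N) (\sum_(i <- r) L i).
Proof.
move=> uL; elim: r => [|i r IH].
  rewrite big_nil; under [fun N => _]eq_fun do rewrite big_nil.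
  exact: polycvgC (cvg_cst 0).
rewrite big_cons; under [fun N => _]eq_fun do rewrite big_cons.
exact: polycvgD.
Qed.

(** The antiderivative is determined by its derivative and its value at [0]. *)
Lemma polycvg_deriv u L :
  polycvg (fun N => (u N)^`()) L^`() -> (fun N => (u N).[0]) @ \oo --> L.[0] ->
  polycvg u L.
Proof.
move=> [[d sd] uL] u0; split=> [|[|k]].
- exists d.+1 => N; apply/leq_sizeP => -[//|j]; rewrite ltnS => ledj.
  have := nth_default 0 (leq_trans (sd N) ledj).
  by rewrite coef_deriv => /eqP; rewrite mulrn_eq0 /= => /eqP.
- by rewrite -horner_coef0; under eq_fun do rewrite -horner_coef0.
have k0 : k.+1%:R != 0 :> F by rewrite pnatr_eq0.
have e (p : {poly F}) : p`_k.+1 = p^`()`_k * k.+1%:R^-1.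
  by rewrite coef_deriv -[X in X / _]mulr_natr mulfK.
rewrite e; under eq_fun do rewrite e.
exact: cvgM (uL k) (cvg_cst (k.+1%:R^-1 : F)).
Qed.
End PolyConvergence.

Section RootMoments.
Variable R : realType.
Local Notation C := (Cplx R).

Lemma is_derive_root_moment (N : nat) (p : {poly C}) (a : nat) (tau : C) :
  (0 < N)%N -> size p = N.+1 ->
  is_derive tau 1 (root_moment p N a)
    ((2%:R * N%:R)^-1 * a%:R * (a%:R - 1) * root_moment p N (a - 2) tau
     - a%:R / 2%:R * \sum_(0 <= b < a.-1)
         root_moment p N b tau * root_moment p N (a - b - 2) tau).
Proof.
move=> N0 sp; have [m [_ mE dm]] := root_moment_poly N0 sp.
have -> : root_moment p N a = horner (m a) by apply/funext => t; apply: mE.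
apply: is_derive_eq; first exact: is_derive_horner.
rewrite dm hornerD hornerN !hornerZ horner_sum mE; congr (_ - _ * _).
by apply: eq_bigr => b _; rewrite hornerM !mE.
Qed.

Lemma cvg_invS : (fun n : nat => n.+1%:R^-1 : C) @ \oo --> (0 : C).
Proof.
apply/cvgr0Pnorm_lt => e e0.
have [Re0 eE] : 0 < complex.Re e /\ e = (complex.Re e)%:C%C.
  by case: e e0 => x y; rewrite ltcE /= => /andP[/eqP -> ->].
have := @cvg_harmonic R; move/cvgr0Pnorm_lt => /(_ _ Re0).
apply: filterS => n /=.
have -> : n.+1%:R^-1 = (n.+1%:R^-1)%:C%C :> C by rewrite fmorphV rmorph_nat.
by rewrite eE normc_def /= expr0n addr0 sqrtr_sqr ltcR.
Qed.

(** Course-of-values induction on the index of the moment: the derivative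
    converges because lower moments do and the term in [1 / N] drops out. *)
Lemma root_moment_limit (p : nat -> {poly C}) :
  (forall N : nat, (0 < N)%N -> size (p N) = N.+1) ->
  (forall a : nat, cvgn (fun N => root_moment (p N) N a 0)) ->
  exists m : nat -> {poly C},
    (forall a tau, (fun N => root_moment (p N) N a tau) @ \oo --> (m a).[tau]) /\
    forall a, (m a)^`() =
      - (a%:R / 2%:R) *: \sum_(0 <= b < a.-1) m b * m (a - b - 2)%N.
Proof.
move=> sp cv0.
have [m [m0 dm]] := moment_flow_exists (fun a => limn (fun N => root_moment (p N) N a 0)).
exists m; split=> // a tau.
(* N is shifted by one because the degrees are prescribed only for N > 0. *)
have [u uP] := choice (fun N => root_moment_poly (ltn0Sn N) (sp _ (ltn0Sn N))).
suff um b : polycvg (fun N => u N b) (m b).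
  rewrite -(cvg_shiftS (fun N => root_moment (p N) N a tau)).
  under eq_fun do rewrite (let: And3 _ h _ := uP _ in h).
  exact: polycvg_horner.
have u0 c : (fun N => (u N c).[0]) @ \oo --> (m c).[0].
  rewrite m0; have := cv0 c; rewrite -(cvg_shiftS (fun N => root_moment (p N) N c 0)).
  by under eq_fun do rewrite (let: And3 _ h _ := uP _ in h).
elim/ltn_ind: b => b IH; apply: polycvg_deriv; last exact: u0.
rewrite dm.
under eq_fun do rewrite (let: And3 _ _ h := uP _ in h).
case: b IH => [|b] IH.
  under eq_fun do rewrite !(mulr0, mul0r, oppr0, scale0r, subr0).
  by rewrite mul0r oppr0 scale0r; apply: polycvgC (cvg_cst (0 : C)).
rewrite scaleNr -[X in polycvg _ X]add0r; apply: polycvgD.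
  have lt : (b.+1 - 2 < b.+1)%N by rewrite ltn_subrL.
  under eq_fun do rewrite -mul_polyC.
  rewrite -(mul0r (m (b.+1 - 2)%N)); apply: polycvgM; last exact: IH lt.
  apply: polycvgC.
  pose k := b.+1%:R * (b.+1%:R - 1) : C.
  have h : (fun n : nat => 2%:R^-1 * n.+1%:R^-1 * k) @ \oo --> (2%:R^-1 * 0 * k : C).
    exact: cvgM (cvgM (cvg_cst _) cvg_invS) (cvg_cst k).
  rewrite mulr0 mul0r in h; apply: cvg_trans h.
  by apply: near_eq_cvg; apply: nearW => n; rewrite /k invfM !mulrA.
rewrite -scaleNr -mul_polyC big_mkord.
under eq_fun do rewrite -scaleNr -mul_polyC big_mkord.
apply: polycvgM; first exact: polycvgC (cvg_cst _).
apply: polycvg_sum => i; apply: polycvgM; apply: IH.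
  by rewrite (leq_trans (ltn_ord i)) // leq_pred.
by rewrite subnAC (leq_ltn_trans (leq_subr _ _)) // ltn_subrL.
Qed.

Lemma is_derive_limit_root_moment (p : nat -> {poly C}) :
  (forall N : nat, (0 < N)%N -> size (p N) = N.+1) ->
  (forall a : nat, cvgn (fun N => root_moment (p N) N a 0)) ->
  forall (a : nat) (tau : C),
    cvgn (fun N => root_moment (p N) N a tau) /\
    is_derive tau 1 (limit_root_moment p a)
      (- (a%:R / 2%:R) * \sum_(0 <= b < a.-1)
         limit_root_moment p b tau * limit_root_moment p (a - b - 2) tau).
Proof.
move=> sp cv0 a tau; have [m [mL dm]] := root_moment_limit sp cv0.
have limE b : limit_root_moment p b = horner (m b).
  by apply/funext => t; apply/cvg_lim => //; apply: mL.
split; first exact: (cvgP _ (mL a tau)).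
rewrite limE; apply: is_derive_eq; first exact: is_derive_horner.
rewrite dm hornerZ horner_sum; congr (_ * _).
by apply: eq_bigr => b _; rewrite hornerM !limE.
Qed.
End RootMoments.

(** * Real and imaginary parts, and real differentiation *)
Section ComplexFacts.
Variable R : realType.
Local Notation C := (Cplx R).
Local Notation Re := (@complex.Re R).
Local Notation Im := (@complex.Im R).
Local Notation nc := (@Normc.normc R).
Implicit Types (z w : C) (x y : R).

Lemma CReD z w : Re (z + w) = Re z + Re w.
Proof. by case: z w => [? ?] [? ?]. Qed.
Lemma CImD z w : Im (z + w) = Im z + Im w.
Proof. by case: z w => [? ?] [? ?]. Qed.
Lemma CReN z : Re (- z) = - Re z.
Proof. by case: z. Qed.
Lemma CImN z : Im (- z) = - Im z.
Proof. by case: z. Qed.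
Lemma CReM z w : Re (z * w) = Re z * Re w - Im z * Im w.
Proof. by case: z w => [? ?] [? ?]. Qed.
Lemma CImM z w : Im (z * w) = Re z * Im w + Im z * Re w.
Proof. by case: z w => [? ?] [? ?]. Qed.
Lemma ncE z : nc z ^+ 2 = Re z ^+ 2 + Im z ^+ 2.
Proof. by case: z => a b /=; rewrite sqr_sqrtr // addr_ge0 ?sqr_ge0. Qed.
Lemma nc_ge0 z : 0 <= nc z.
Proof. by case: z => a b /=; rewrite sqrtr_ge0. Qed.
Lemma ncM z w : nc (z * w) = nc z * nc w.
Proof. exact: Normc.normcM. Qed.
Lemma ncV z : nc z^-1 = (nc z)^-1.
Proof. exact: Normc.normcV. Qed.
Lemma ncD z w : nc (z + w) <= nc z + nc w.
Proof. exact: le_normcD. Qed.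
Lemma ncN z : nc (- z) = nc z.
Proof. exact: normcN. Qed.
Lemma nc1 : nc (1 : C) = 1.
Proof. exact: Normc.normc1. Qed.
Lemma nc0 : nc (0 : C) = 0.
Proof. exact: Normc.normc0. Qed.
Lemma nc_eq0 z : (nc z == 0) = (z == 0).
Proof. by apply/eqP/eqP => [/Normc.eq0_normc|->] //; rewrite nc0. Qed.
Lemma nc_gt0 z : (0 < nc z) = (z != 0).
Proof. by rewrite lt_neqAle nc_ge0 andbT eq_sym nc_eq0. Qed.
Lemma ncX z n : nc (z ^+ n) = nc z ^+ n.
Proof. by elim: n => [|n IH]; rewrite ?expr0 ?nc1 // !exprS ncM IH. Qed.
Lemma nc_sum I (r : seq I) (F : I -> C) : nc (\sum_(i <- r) F i) <= \sum_(i <- r) nc (F i).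
Proof.
elim/big_rec2: _ => [|i x y _ le]; first by rewrite nc0.
by apply: le_trans (ncD _ _) _; rewrite lerD2l.
Qed.
Lemma ncB z w : nc z - nc w <= nc (z - w).
Proof. by rewrite lerBlDr; apply: le_trans (ncD _ _); rewrite subrK. Qed.
Lemma normr_Re_le z : `|Re z| <= nc z.
Proof.
rewrite -[leRHS]ger0_norm ?nc_ge0 // -ler_sqr ?nnegrE //.
by rewrite !real_normK ?num_real // ncE lerDl sqr_ge0.
Qed.
Lemma normr_Im_le z : `|Im z| <= nc z.
Proof.
rewrite -[leRHS]ger0_norm ?nc_ge0 // -ler_sqr ?nnegrE //.
by rewrite !real_normK ?num_real // ncE lerDr sqr_ge0.
Qed.
Lemma Re_le_nc z : Re z <= nc z.
Proof. exact: le_trans (ler_norm _) (normr_Re_le _). Qed.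
Lemma nc_le_ReIm z : nc z <= `|Re z| + `|Im z|.
Proof.
rewrite -[leLHS]ger0_norm ?nc_ge0 // -ler_sqr ?nnegrE ?addr_ge0 // real_normK ?num_real //.
rewrite ncE sqrrD !real_normK ?num_real // lerD2r lerDl mulrn_wge0 // mulr_ge0 //.
Qed.
Lemma nc_real x : nc (x%:C%C : C) = `|x|.
Proof. by rewrite /= expr0n addr0 sqrtr_sqr. Qed.
Lemma normCE z : `|z| = (nc z)%:C%C :> C.
Proof. by case: z. Qed.
Lemma CReMr x z : Re ((x%:C%C : C) * z) = x * Re z.
Proof. by rewrite CReM /= mul0r subr0. Qed.
Lemma CImMr x z : Im ((x%:C%C : C) * z) = x * Im z.
Proof. by rewrite CImM /= mul0r addr0. Qed.
Lemma CReV z : Re z^-1 = Re z / nc z ^+ 2.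
Proof. by rewrite ncE; case: z => a b. Qed.
Lemma CImV z : Im z^-1 = - Im z / nc z ^+ 2.
Proof. by rewrite ncE; case: z => a b /=; rewrite mulNr. Qed.
Lemma C_eta z : z = (Re z +i* Im z)%C.
Proof. by case: z. Qed.
Lemma C_eq z w : Re z = Re w -> Im z = Im w -> z = w.
Proof. by case: z w => [? ?] [? ?] /= -> ->. Qed.
End ComplexFacts.

Section Calculus.
Variables (R : realType) (E : normedModType R).
Local Notation C := (Cplx R).
Local Notation Re := (@complex.Re R).
Local Notation Im := (@complex.Im R).
Local Notation nc := (@Normc.normc R).
Variables (q v : E).

(** Full differentiability is recorded with the value in one direction, as the
    chain rule needs it while only directional derivatives are computed. *)
Definition rdiff (f : E -> R) (d : R) := differentiable f q /\ 'D_v f q = d.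

(** Componentwise, because [E] is normed over [R] while [C] is normed over
    itself. *)
Definition cdiff (g : E -> C) (d : C) :=
  rdiff (fun x => Re (g x)) (Re d) /\ rdiff (fun x => Im (g x)) (Im d).

Lemma rdiff_eq f d d' : rdiff f d -> d = d' -> rdiff f d'.
Proof. by move=> ? <-. Qed.
Lemma cdiff_eq f d d' : cdiff f d -> d = d' -> cdiff f d'.
Proof. by move=> ? <-. Qed.

Lemma rdiff_cst (c : R) : rdiff (fun=> c) 0.
Proof. by split; [exact: differentiable_cst | exact: derive_cst]. Qed.

Lemma rdiffD (f g : E -> R) (d e : R) : rdiff f d -> rdiff g e ->
  rdiff (fun x => f x + g x) (d + e).
Proof.
move=> [df <-] [dg <-]; split; first exact: differentiableD.
by rewrite -deriveD //; apply: diff_derivable.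
Qed.

Lemma rdiffN (f : E -> R) (d : R) : rdiff f d -> rdiff (fun x => - f x) (- d).
Proof.
move=> [df <-]; split; first exact: differentiableN.
by rewrite -deriveN //; apply: diff_derivable.
Qed.

Lemma rdiffB (f g : E -> R) (d e : R) : rdiff f d -> rdiff g e ->
  rdiff (fun x => f x - g x) (d - e).
Proof. by move=> df dg; apply: rdiffD => //; apply: rdiffN. Qed.

Lemma rdiffM (f g : E -> R) (d e : R) : rdiff f d -> rdiff g e ->
  rdiff (fun x => f x * g x) (f q * e + g q * d).
Proof.
move=> [df <-] [dg <-]; split; first exact: differentiableM.
by rewrite deriveM //; apply: diff_derivable.
Qed.

Lemma rdiff_comp (phi : R -> R) (f : E -> R) (d dphi : R) : is_derive (f q) 1 phi dphi ->
  rdiff f d -> rdiff (fun x => phi (f x)) (dphi * d).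
Proof.
move=> [dp <-] [df <-]; have dpf : differentiable phi (f q) by apply/derivable1_diffP.
have dc : differentiable (phi \o f) q by apply: differentiable_comp.
split=> //; rewrite deriveE // diff_comp // deriveE //= deriveE //.
rewrite -[in LHS](mulr1 ('d f q v)) -/('d f q v *: 1) linearZ /=.
by rewrite mulrC.
Qed.

Lemma rdiff_ln (f : E -> R) (d : R) : 0 < f q -> rdiff f d ->
  rdiff (fun x => ln (f x)) (d / f q).
Proof.
move=> f0 df; rewrite mulrC; exact: rdiff_comp (is_derive1_ln f0) df.
Qed.

Lemma rdiffV (f : E -> R) (d : R) : f q != 0 -> rdiff f d ->
  rdiff (fun x => (f x)^-1) (- (d / f q ^+ 2)).
Proof.
move=> f0 [df <-]; split; first exact: differentiableV.
rewrite deriveV //; last exact: diff_derivable.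
by rewrite /GRing.scale /= mulNr mulrC.
Qed.

Lemma rdiffMl (c : R) (f : E -> R) (d : R) : rdiff f d -> rdiff (fun x => c * f x) (c * d).
Proof.
move=> df; apply: rdiff_eq; first by apply: rdiffM; [exact: rdiff_cst | exact: df].
by rewrite mulr0 addr0.
Qed.

Lemma rdiffX n (f : E -> R) (d : R) : rdiff f d ->
  rdiff (fun x => f x ^+ n) (n%:R * f q ^+ n.-1 * d).
Proof.
move=> df; elim: n => [|n IH]; first by rewrite !mul0r; apply: rdiff_cst.
under eq_fun do rewrite exprS.
apply: rdiff_eq; first exact: rdiffM df IH.
case: n {IH} => [|n] /=; first by rewrite expr0; ring.
by rewrite exprS; ring.
Qed.

Lemma cdiff_cst (c : C) : cdiff (fun=> c) 0.
Proof. by split; apply: rdiff_cst. Qed.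

Lemma cdiffD (f g : E -> C) (d e : C) : cdiff f d -> cdiff g e ->
  cdiff (fun x => f x + g x) (d + e).
Proof.
move=> [f1 f2] [g1 g2]; split; rewrite ?CReD ?CImD.
  by under eq_fun do rewrite CReD; apply: rdiffD.
by under eq_fun do rewrite CImD; apply: rdiffD.
Qed.

Lemma cdiffN (f : E -> C) (d : C) : cdiff f d -> cdiff (fun x => - f x) (- d).
Proof.
move=> [f1 f2]; split; rewrite ?CReN ?CImN.
  by under eq_fun do rewrite CReN; apply: rdiffN.
by under eq_fun do rewrite CImN; apply: rdiffN.
Qed.

Lemma cdiffB (f g : E -> C) (d e : C) : cdiff f d -> cdiff g e ->
  cdiff (fun x => f x - g x) (d - e).
Proof. by move=> df dg; apply: cdiffD => //; apply: cdiffN. Qed.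

Lemma cdiffM (f g : E -> C) (d e : C) : cdiff f d -> cdiff g e ->
  cdiff (fun x => f x * g x) (f q * e + g q * d).
Proof.
move=> [f1 f2] [g1 g2]; split.
  under eq_fun do rewrite CReM.
  apply: rdiff_eq; first by apply: rdiffB; apply: rdiffM; eassumption.
  by rewrite CReD !CReM; ring.
under eq_fun do rewrite CImM.
apply: rdiff_eq; first by apply: rdiffD; apply: rdiffM; eassumption.
by rewrite CImD !CImM; ring.
Qed.

Lemma cdiff_sum I (r : seq I) (f : I -> E -> C) (d : I -> C) :
  (forall i, cdiff (f i) (d i)) ->
  cdiff (fun x => \sum_(i <- r) f i x) (\sum_(i <- r) d i).
Proof.
move=> df; elim: r => [|i r IH].
  by rewrite big_nil; under [fun x => _]eq_fun do rewrite big_nil; apply: cdiff_cst.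
rewrite big_cons; under [fun x => _]eq_fun do rewrite big_cons.
exact: cdiffD.
Qed.

Lemma cdiffX n (f : E -> C) (d : C) : cdiff f d ->
  cdiff (fun x => f x ^+ n) (n%:R * f q ^+ n.-1 * d).
Proof.
move=> df; elim: n => [|n IH].
  by rewrite !mul0r; apply: cdiff_cst.
under eq_fun do rewrite exprS.
apply: cdiff_eq; first exact: cdiffM df IH.
case: n {IH} => [|n] /=; first by rewrite expr0; ring.
by rewrite exprS; ring.
Qed.

Lemma rdiff_normsq (f : E -> C) (d : C) : cdiff f d ->
  rdiff (fun x => nc (f x) ^+ 2) (2%:R * (Re (f q) * Re d + Im (f q) * Im d)).
Proof.
move=> [f1 f2]; under eq_fun do rewrite ncE !expr2.
apply: rdiff_eq; first by apply: rdiffD; apply: rdiffM; eassumption.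
ring.
Qed.

Lemma cdiffV (f : E -> C) (d : C) : f q != 0 -> cdiff f d ->
  cdiff (fun x => (f x)^-1) (- (d / f q ^+ 2)).
Proof.
move=> f0 df; have [f1 f2] := df.
have n0 : nc (f q) ^+ 2 != 0 by rewrite expf_neq0 // nc_eq0.
have dn := rdiffV n0 (rdiff_normsq df).
have e : nc (f q) ^+ 2 = Re (f q) ^+ 2 + Im (f q) ^+ 2 by rewrite ncE.
have e2 : (f q ^+ 2)^-1 = (f q)^-1 * (f q)^-1 by rewrite -exprVn expr2.
split.
  under eq_fun do rewrite CReV.
  apply: rdiff_eq; first exact: rdiffM f1 dn.
  rewrite e2 CReN !(CReM, CImM) CReV CImV.
  by rewrite e in n0 *; field.
under eq_fun do rewrite CImV.
apply: rdiff_eq; first exact: rdiffM (rdiffN f2) dn.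
rewrite e2 CImN !(CReM, CImM) CReV CImV.
by rewrite e in n0 *; field.
Qed.

Lemma cdiff_horner (p : {poly C}) (f : E -> C) (d : C) : cdiff f d ->
  cdiff (fun x => p.[f x]) (p^`().[f q] * d).
Proof.
move=> df; elim/poly_ind: p => [|p c IH].
  rewrite deriv0 horner0 mul0r; under eq_fun do rewrite horner0.
  exact: cdiff_cst.
under eq_fun do rewrite hornerD hornerM hornerX hornerC.
apply: cdiff_eq; first by apply: cdiffD (cdiff_cst c); apply: cdiffM IH df.
by rewrite derivD derivM derivX derivC !addr0 mulr1 !(hornerD, hornerM, hornerX); ring.
Qed.

Lemma rdiff_ln_normsq (f : E -> C) (d : C) : f q != 0 -> cdiff f d ->
  rdiff (fun x => ln (nc (f x) ^+ 2)) (2%:R * Re (d / f q)).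
Proof.
move=> f0 df; have n0 : 0 < nc (f q) ^+ 2 by rewrite exprn_gt0 // nc_gt0.
apply: rdiff_eq; first by exact: rdiff_ln n0 (rdiff_normsq df).
by rewrite CReM CReV CImV; ring.
Qed.
End Calculus.

(** * The log potential near infinity *)
Section LogExpansion.
Variable R : realType.
Local Notation C := (Cplx R).
Local Notation Re := (@complex.Re R).
Local Notation nc := (@Normc.normc R).

(** Along [t |-> t zeta] the derivative of the remainder is
    [- 2 Re (zeta (t zeta)^n / (1 - t zeta))] by summing a geometric series, and
    [|1 - t zeta| >= 1/2]; the mean value theorem concludes. *)
Lemma log_expansion (n : nat) (zeta : C) : nc zeta <= 2^-1 ->
  `|ln (nc (1 - zeta) ^+ 2)
    + 2 * Re (\sum_(a < n) zeta ^+ a.+1 / a.+1%:R)| <= 4 * nc zeta ^+ n.+1.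
Proof.
move=> zs.
pose f (t : R) : C := 1 - t%:C%C * zeta.
pose g (t : R) := ln (nc (f t) ^+ 2)
    + 2 * Re (\sum_(a < n) (t%:C%C * zeta) ^+ a.+1 / a.+1%:R).
have dt (t : R) : cdiff t (1 : R) (fun t : R => t%:C%C : C) (1%:C%C : C).
  split; split => /=.
  - exact: (@ex_diff _ _ _ _ _ _ _ (is_diff_id t)).
  - exact: derive_id.
  - exact: differentiable_cst.
  - exact: derive_cst.
have dtz t : cdiff t (1 : R) (fun t : R => t%:C%C * zeta : C) zeta.
  apply: cdiff_eq; first by apply: cdiffM (dt t) (cdiff_cst _ _ zeta).
  by rewrite mulr0 add0r mulr1.
have df t : cdiff t (1 : R) f (- zeta).
  apply: cdiff_eq; first by apply: cdiffB (cdiff_cst _ _ 1) (dtz t).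
  by rewrite sub0r.
pose g' (t : R) := 2 * Re (- zeta / f t) + 2 * Re (\sum_(a < n) (t%:C%C * zeta) ^+ a * zeta).
have ncf (t : R) : 0 <= t <= 1 -> 2^-1 <= nc (f t).
  move=> /andP[t0 t1]; apply: le_trans (ncB _ _); rewrite nc1 ncM nc_real ger0_norm //.
  have : t * nc zeta <= 1 * 2^-1 by apply: ler_pM => //; apply: nc_ge0.
  lra.
have f0 (t : R) : 0 <= t <= 1 -> f t != 0.
  by move=> /ncf le; rewrite -nc_gt0 (lt_le_trans _ le).
have dg (t : R) : 0 <= t <= 1 -> rdiff t (1 : R) g (g' t).
  move=> t01; apply: rdiffD; first exact: rdiff_ln_normsq (f0 t t01) (df t).
  apply: rdiffMl; apply: (proj1 (cdiff_sum _ _)) => a.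
  apply: cdiff_eq; first by apply: cdiffM (cdiffX a.+1 (dtz t)) (cdiff_cst _ _ _).
  by rewrite mulr0 add0r /= !mulrA mulVf ?mul1r // pnatr_eq0.
have g'le (t : R) : 0 <= t <= 1 -> `|g' t| <= 4 * nc zeta ^+ n.+1.
  move=> t01; have := f0 t t01; have := ncf t t01; rewrite /g' /f.
  set x := t%:C%C * zeta => lex x0.
  have -> : 2 * Re (- zeta / (1 - x)) + 2 * Re (\sum_(a < n) x ^+ a * zeta)
       = - 2 * Re (zeta * x ^+ n / (1 - x)).
    rewrite -mulrDr -CReD -mulr_suml mulNr -mulrN -CReN; congr (_ * Re _).
    have e : \sum_(a < n) x ^+ a = (1 - x ^+ n) / (1 - x).
      by apply: (mulIf x0); rewrite divfK // mulrC -opprB mulNr -subrX1 opprB.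
    by rewrite e; field.
  rewrite normrM normrN normr_nat; apply: (@le_trans _ _ (2 * nc (zeta * x ^+ n / (1 - x)))).
    by rewrite ler_wpM2l // normr_Re_le.
  rewrite !ncM ncV ncX exprS.
  have -> : 4 * (nc zeta * nc zeta ^+ n) = 2 * (nc zeta * (2 * nc zeta ^+ n)) by ring.
  rewrite ler_pM2l // -mulrA; apply: ler_wpM2l; first exact: nc_ge0.
  rewrite mulrC; apply: ler_pM.
  - by rewrite invr_ge0 nc_ge0.
  - by rewrite exprn_ge0 // nc_ge0.
  - by rewrite invf_ple ?posrE // (lt_le_trans _ lex).
  - have /andP[t0 t1] := t01.
    rewrite lerXn2r ?nnegrE ?nc_ge0 // /x ncM nc_real ger0_norm // ler_piMl ?nc_ge0 //.
have [|||c cin] := @MVT_segment R g g' 0 1.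
- by [].
- move=> t tin; have t01 : 0 <= t <= 1 by move: tin; rewrite in_itv /= => /andP[/ltW -> /ltW ->].
  have [dgt <-] := dg t t01.
  by apply/derivableP; apply: diff_derivable.
- apply: continuous_in_subspaceT => t; rewrite inE /= in_itv /= => t01.
  by apply: differentiable_continuous; case: (dg t t01).
have z0 : (0 : R)%:C%C * zeta = 0 := mul0r zeta.
have z1 : (1 : R)%:C%C * zeta = zeta := mul1r zeta.
have g0 : g 0 = 0.
  rewrite /g /f z0 subr0 nc1 expr1n ln1 big1 ?mulr0 ?addr0 //.
  by move=> a _; rewrite expr0n mul0r.
rewrite g0 !subr0 mulr1 => e.
by have := g'le c cin; rewrite -e /g /f z1.
Qed.
End LogExpansion.

Section Borel.
Variable R : realType.
Local Notation C := (Cplx R).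
Local Notation Re := (@complex.Re R).
Local Notation Im := (@complex.Im R).
Local Notation nc := (@Normc.normc R).

(** The balls of [C] over itself have complex radii; real radii suffice. *)
Lemma nc_ballP (z : C) (P : set C) : nbhs z P <->
  exists2 e : R, 0 < e & forall w, nc (z - w) < e -> P w.
Proof.
split.
  move=> /nbhs_ballP[e /= e0 eP].
  have [Re0 eE] : 0 < Re e /\ e = (Re e)%:C%C.
    by case: e e0 {eP} => x y; rewrite ltcE /= => /andP[/eqP -> ->].
  exists (Re e) => // w we; apply: eP; rewrite -ball_normE /= normCE eE ltcR //.
move=> [e e0 eP]; apply/nbhs_ballP; exists (e%:C%C : C) => /=; first by rewrite ltcR.
by move=> w; rewrite -ball_normE /= normCE ltcR; apply: eP.
Qed.

Lemma nc_continuous_lip (f : C -> R) :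
  (forall z w, `|f z - f w| <= nc (z - w)) -> continuous f.
Proof.
move=> lipf z; apply/(@cvgrPdist_lt _ _ _ (nbhs z) (nbhs_filter z)) => e e0.
by apply/nc_ballP; exists e => // w; apply: le_lt_trans.
Qed.

Lemma continuous_Re : continuous (Re : C -> R).
Proof. by apply: nc_continuous_lip => z w; rewrite -CReN -CReD normr_Re_le. Qed.
Lemma continuous_Im : continuous (Im : C -> R).
Proof. by apply: nc_continuous_lip => z w; rewrite -CImN -CImD normr_Im_le. Qed.
Lemma continuous_nc : continuous (nc : C -> R).
Proof.
apply: nc_continuous_lip => z w; rewrite ler_norml ncB andbT lerNl opprB.
by rewrite -[leRHS]ncN opprB ncB.
Qed.

Lemma measurable_Cborel (f : C -> R) : continuous f ->
  measurable_fun setT (f : Cborel R -> R).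
Proof.
move=> /continuousP cf; apply: (measurability _ (RGenOpens.measurableE R)).
move=> _ [_ [a [b ->] <-]]; rewrite setTI; apply: sub_sigma_algebra.
exact/cf/interval_open.
Qed.

Lemma measurable_Re : measurable_fun setT (Re : Cborel R -> R).
Proof. by apply: measurable_Cborel; exact: continuous_Re. Qed.
Lemma measurable_Im : measurable_fun setT (Im : Cborel R -> R).
Proof. by apply: measurable_Cborel; exact: continuous_Im. Qed.
Lemma measurable_nc : measurable_fun setT (nc : Cborel R -> R).
Proof. by apply: measurable_Cborel; exact: continuous_nc. Qed.

Lemma measurable_ReIm_exp (n : nat) :
  measurable_fun setT (fun w : Cborel R => Re ((w : C) ^+ n)) /\
  measurable_fun setT (fun w : Cborel R => Im ((w : C) ^+ n)).
Proof.
elim: n => [|n [mr mi]]; first by split; apply: measurable_cst.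
split.
  under eq_fun do rewrite exprS CReM.
  by apply: measurable_funB; apply: measurable_funM => //;
    [exact: measurable_Re | exact: measurable_Im].
under eq_fun do rewrite exprS CImM.
by apply: measurable_funD; apply: measurable_funM => //;
    [exact: measurable_Re | exact: measurable_Im].
Qed.

Lemma measurable_lne_normsq (z : C) :
  measurable_fun setT (fun w : Cborel R => lne ((nc (z - (w : C)) ^+ 2)%:E)).
Proof.
have mn : measurable_fun setT (fun w : Cborel R => nc (z - (w : C)) ^+ 2).
  under eq_fun do rewrite ncE CReD CImD CReN CImN.
  apply: measurable_funD; apply: measurable_funX; apply: measurable_funB => //.
    exact: measurable_Re.
  exact: measurable_Im.
rewrite /lne; apply: measurable_fun_ifT.
- exact: measurable_fun_ler.
- exact: measurable_cst.
- by apply/measurable_EFinP; apply: measurableT_comp => //; exact: measurable_ln.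
Qed.

Lemma compactly_supported_bounded (mu : probability (Cborel R) R) :
  compactly_supported mu ->
  exists2 rho : R, 0 < rho & mu [set w : Cborel R | rho < nc w] = 0%E.
Proof.
move=> [K [cK muK]].
have /compact_bounded [M [_ MP]] : compact (nc @` K).
  by apply: continuous_compact => //; apply: continuous_subspaceT; exact: continuous_nc.
have {}MP w : K w -> nc w <= `|M| + 1.
  move=> Kw; have := MP (`|M| + 1); rewrite (le_lt_trans (ler_norm _)) ?ltrDl //.
  by move=> /(_ isT (nc w)) /=; rewrite ger0_norm ?nc_ge0 //; apply; exists w.
exists (`|M| + 1); first by rewrite ltr_wpDl.
apply/eqP; rewrite -measure_le0 -muK; apply: le_measure; rewrite ?inE.
- have := measurable_nc measurableT (measurable_itv `]`|M| + 1, +oo[).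
  by rewrite setTI; congr measurable; apply/seteqP; split => w /=; rewrite in_itv /= andbT.
- apply: sub_sigma_algebra; rewrite openC.
  by apply: compact_closed => //; exact: norm_hausdorff.
- by move=> w /= + Kw; rewrite ltNge MP.
Qed.
End Borel.

Section Potential.
Variable R : realType.
Local Notation C := (Cplx R).
Local Notation Re := (@complex.Re R).
Local Notation Im := (@complex.Im R).
Local Notation nc := (@Normc.normc R).
Variable mu : probability (Cborel R) R.

(** The measure of a compact support lives on a disc [D] of radius [rho], up to
    the null set [N]; this replaces a pointwise bound on integrands by a bound on
    [D]. *)
Section EssentiallyBounded.
Variable rho : R.
Hypothesis rho0 : 0 < rho.
Let N : set (Cborel R) := [set w | rho < nc w].
Hypothesis muN : mu N = 0%E.

Lemma measurable_far : measurable N.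
Proof.
have := @measurable_nc R measurableT _ (measurable_itv `]rho, +oo[).
by rewrite setTI; congr measurable; apply/seteqP; split => w /=; rewrite in_itv /= andbT.
Qed.

Let D := setT `\` N.
Lemma measurable_near : measurable D.
Proof. by apply: measurableD => //; exact: measurable_far. Qed.

Lemma nearP w : D w -> nc w <= rho.
Proof. by move=> [_ /=] /negP; rewrite -leNgt. Qed.

Lemma integrable_near_T (f : Cborel R -> \bar R) (K : R) : measurable_fun setT f ->
  (forall w, nc w <= rho -> (`|f w| <= K%:E)%E) ->
  mu.-integrable D f /\ mu.-integrable setT f.
Proof.
move=> mf fK; suff iD : mu.-integrable D f.
  by split=> //; apply/(negligible_integrable measurable_far measurableT mf muN).
apply: (@le_integrable _ _ _ mu D measurable_near f (EFin \o cst `|K|)).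
- exact: measurable_funTS.
- move=> w /nearP /fK /le_trans; apply.
  by rewrite /= normr_id lee_fin ler_norm.
- by apply: finite_measure_integrable_cst; exact: measurable_near.
Qed.

(** Transfers a pointwise estimate on the disc to integrals; [f] is extended
    real because it will be a logarithm, infinite at one point. *)
Lemma Rintegral_close (f : Cborel R -> \bar R) (h : Cborel R -> R) (K e : R) :
  measurable_fun setT f -> measurable_fun setT h ->
  (forall w, nc w <= rho -> `|h w| <= K) ->
  (forall w, nc w <= rho -> ((h w - e)%:E <= f w <= (h w + e)%:E)%E) ->
  (\int[mu]_w f w)%E \is a fin_num /\
  `|fine (\int[mu]_w f w)%E - \int[mu]_w h w| <= e.
Proof.
move=> mf mh hK fh.
have mh' : measurable_fun setT (EFin \o h) by apply/measurable_EFinP.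
have [hD hT] := @integrable_near_T (EFin \o h) K mh' (fun w wr => hK w wr).
have ff w : nc w <= rho -> f w \is a fin_num.
  by move=> /fh /andP[le1 le2]; rewrite fin_numE; apply/andP; split; apply/eqP => e';
    move: le1 le2; rewrite e'.
have [fD fT] : mu.-integrable D f /\ mu.-integrable setT f.
  apply: (@integrable_near_T f (K + `|e|)) => // w wr.
  have := fh w wr; have /hK := wr; rewrite -(fineK (ff w wr)) !lee_fin /= => le1 /andP[le2 le3].
  move: le1; rewrite !ler_norml => /andP[? ?]; have := ler_norm e.
  by move=> ?; apply/andP; split; lra.
split; first exact: integrable_fin_num.
have muD : fine (mu D) = 1.
  by rewrite /D setTD probability_setC ?muN ?sube0 //; exact: measurable_far.
have ffD : mu.-integrable D (EFin \o (fine \o f)).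
  apply: eq_integrable fD => //; first exact: measurable_near.
  by move=> w /set_mem /nearP /ff /fineK.
have -> : fine (\int[mu]_w f w)%E = \int[mu]_(w in D) fine (f w).
  rewrite (negligible_integral measurable_far) // /Rintegral; congr fine.
  by apply: eq_integral => w /set_mem /nearP /ff /fineK.
have -> : \int[mu]_w h w = \int[mu]_(w in D) h w.
  by rewrite /Rintegral (negligible_integral measurable_far).
have ce c : mu.-integrable D (EFin \o cst c).
  by apply: finite_measure_integrable_cst; exact: measurable_near.
have cE c : \int[mu]_(w in D) c = c by rewrite Rintegral_cst ?muD ?mulr1 //; exact: measurable_near.
have le1 : \int[mu]_(w in D) fine (f w) <= \int[mu]_(w in D) (h w + e).
  apply: le_Rintegral => //; first exact: measurable_near.
    by apply: integrableD (hD) (ce e); exact: measurable_near.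
  by move=> w /nearP wr; have /andP[_] := fh w wr; rewrite -(fineK (ff w wr)) lee_fin.
have le2 : \int[mu]_(w in D) (h w - e) <= \int[mu]_(w in D) fine (f w).
  apply: le_Rintegral => //; first exact: measurable_near.
    by apply: integrableD (hD) (ce (- e)); exact: measurable_near.
  by move=> w /nearP wr; have /andP[+ _] := fh w wr; rewrite -(fineK (ff w wr)) lee_fin.
have mD := measurable_near.
rewrite (RintegralD mD hD (ce _)) cE in le1.
rewrite (RintegralD mD hD (ce _)) cE in le2.
have {}le2 : \int[mu]_(w in D) h w - e <= \int[mu]_(w in D) fine (f w) := le2.
by rewrite ler_norml; apply/andP; split; lra.
Qed.

Lemma integrable_exp (a : nat) :
  mu.-integrable setT (EFin \o (fun w : Cborel R => Re ((w : C) ^+ a))) /\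
  mu.-integrable setT (EFin \o (fun w : Cborel R => Im ((w : C) ^+ a))).
Proof.
have [mr mi] := @measurable_ReIm_exp R a.
have ncw (w : C) : nc w <= rho -> nc (w ^+ a) <= rho ^+ a.
  by move=> wr; rewrite ncX lerXn2r ?nnegrE ?nc_ge0 // ltW.
split; apply: (proj2 (@integrable_near_T _ (rho ^+ a) _ _)).
- exact/measurable_EFinP.
- move=> w /ncw wr; rewrite lee_fin; exact: le_trans (normr_Re_le _) wr.
- exact/measurable_EFinP.
- move=> w /ncw wr; rewrite lee_fin; exact: le_trans (normr_Im_le _) wr.
Qed.

Lemma Rintegral_poly (n : nat) (c : nat -> C) :
  mu.-integrable setT (EFin \o (fun w : Cborel R => Re (\sum_(a < n) c a * (w : C) ^+ a.+1))) /\
  \int[mu]_w Re (\sum_(a < n) c a * (w : C) ^+ a.+1)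
    = Re (\sum_(a < n) c a * holo_moment mu a.+1).
Proof.
have term a : mu.-integrable setT (EFin \o (fun w : Cborel R => Re (c a * (w : C) ^+ a.+1))) /\
    \int[mu]_w Re (c a * (w : C) ^+ a.+1) = Re (c a * holo_moment mu a.+1).
  have [ir ii] := integrable_exp a.+1.
  have ir' : mu.-integrable setT (EFin \o (fun w : Cborel R => Re (c a) * Re ((w : C) ^+ a.+1))).
    by apply: eq_integrable (integrableZl measurableT (Re (c a)) ir).
  have ii' : mu.-integrable setT (EFin \o (fun w : Cborel R => Im (c a) * Im ((w : C) ^+ a.+1))).
    by apply: eq_integrable (integrableZl measurableT (Im (c a)) ii).
  have e : (fun w : Cborel R => Re (c a * (w : C) ^+ a.+1)) =
    (fun w => Re (c a) * Re ((w : C) ^+ a.+1) - Im (c a) * Im ((w : C) ^+ a.+1)).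
    by apply/funext => w; rewrite CReM.
  rewrite e; split; first by apply: eq_integrable (integrableB measurableT ir' ii').
  rewrite (RintegralB measurableT ir' ii') (RintegralZl _ measurableT ir).
  rewrite (RintegralZl _ measurableT ii).
  by rewrite CReM.
elim: n => [|n [IH1 IH2]].
  under eq_fun do rewrite big_ord0.
  split; first exact: (finite_measure_integrable_cst mu 0).
  by rewrite big_ord0 Rintegral_cst // mul0r.
have [t1 t2] := term n.
have e : (fun w : Cborel R => Re (\sum_(a < n.+1) c a * (w : C) ^+ a.+1)) =
   (fun w => Re (\sum_(a < n) c a * (w : C) ^+ a.+1) + Re (c n * (w : C) ^+ n.+1)).
  by apply/funext => w; rewrite big_ord_recr CReD.
rewrite e; split; first by apply: eq_integrable (integrableD measurableT IH1 t1).
by rewrite (RintegralD measurableT IH1 t1) IH2 t2 big_ord_recr CReD.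
Qed.
End EssentiallyBounded.

(** Integrates the expansion of [ln |1 - w / z|^2] over the support, where
    [|w / z| <= 1/2] as soon as [|z|] exceeds twice the radius. *)
Lemma log_potential_expansion (n : nat) : compactly_supported mu ->
  exists r0 K : R, [/\ 0 < r0, 0 <= K & forall z : C, r0 <= nc z ->
    `|fine (log_potential mu z) - (ln (nc z ^+ 2)
      - 2 * Re (\sum_(a < n) holo_moment mu a.+1 * z^-1 ^+ a.+1 / a.+1%:R))|
    <= K * (nc z)^-1 ^+ n.+1].
Proof.
move=> /compactly_supported_bounded [rho rho0 muN].
exists (2 * rho), (4 * rho ^+ n.+1); split; first by rewrite mulr_gt0.
  by rewrite mulr_ge0 // exprn_ge0 // ltW.
move=> z lez; have z0 : 0 < nc z by apply: lt_le_trans lez; rewrite mulr_gt0.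
have zn0 : z != 0 by rewrite -nc_gt0.
pose c a : C := z^-1 ^+ a.+1 / a.+1%:R.
pose p (w : C) := Re (\sum_(a < n) c a * w ^+ a.+1).
pose h (w : Cborel R) := ln (nc z ^+ 2) - 2 * p w.
have [ip pE] := Rintegral_poly rho0 muN n c.
have i2p : mu.-integrable setT (EFin \o (fun w : Cborel R => 2 * p w)).
  by apply: eq_integrable (integrableZl measurableT 2 ip).
have ic : mu.-integrable setT (EFin \o cst (ln (nc z ^+ 2))).
  exact: finite_measure_integrable_cst.
have ih : mu.-integrable setT (EFin \o h).
  by apply: eq_integrable (integrableB measurableT ic i2p).
have hE : \int[mu]_w h w = ln (nc z ^+ 2)
      - 2 * Re (\sum_(a < n) holo_moment mu a.+1 * z^-1 ^+ a.+1 / a.+1%:R).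
  rewrite (RintegralB measurableT ic i2p) (RintegralZl _ measurableT ip) pE.
  rewrite Rintegral_cst // (_ : fine _ = 1); last exact: (congr1 fine (probability_setT mu)).
  rewrite mulr1; congr (_ - _ * Re _).
  by apply: eq_bigr => a _; rewrite /c mulrC mulrA.
rewrite -hE.
pose K := `|ln (nc z ^+ 2)| + 2 * \sum_(a < n) nc (c a) * rho ^+ a.+1.
apply: (proj2 (@Rintegral_close rho muN _ h K _ _ _ _ _)).
- exact: measurable_lne_normsq.
- by apply/measurable_EFinP; case/integrableP: ih.
- move=> w wr; apply: le_trans (ler_normB _ _) _; rewrite lerD2l normrM normr_nat.
  rewrite ler_wpM2l //; apply: le_trans (normr_Re_le _) _; apply: le_trans (nc_sum _ _) _.
  apply: ler_sum => a _; rewrite ncM ncX ler_wpM2l ?nc_ge0 //.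
  by rewrite lerXn2r ?nnegrE ?nc_ge0 // ltW.
move=> w wr; pose zeta : C := w / z.
have zs : nc zeta <= 2^-1.
  by rewrite ncM ncV ler_pdivrMr //; lra.
have zeta1 : 0 < nc (1 - zeta).
  by apply: lt_le_trans (ncB _ _); rewrite nc1; lra.
have zw : z - (w : C) = z * (1 - zeta) by rewrite mulrBr mulr1 /zeta mulrCA mulfV // mulr1.
have lnE : ln (nc (z - (w : C)) ^+ 2) = ln (nc z ^+ 2) + ln (nc (1 - zeta) ^+ 2).
  by rewrite zw ncM exprMn lnM // posrE exprn_gt0.
rewrite lne_EFin ?lnE; last by rewrite zw ncM exprn_gt0 // mulr_gt0.
rewrite !lee_fin; have := log_expansion n zs.
have -> : Re (\sum_(a < n) zeta ^+ a.+1 / a.+1%:R) = p w.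
  by congr Re; apply: eq_bigr => a _; rewrite /c /zeta exprMn mulrC mulrA mulrC mulrA.
have : 4 * nc zeta ^+ n.+1 <= 4 * rho ^+ n.+1 * (nc z)^-1 ^+ n.+1.
  rewrite -mulrA ler_pM2l // -exprMn.
  rewrite lerXn2r ?nnegrE ?nc_ge0 ?mulr_ge0 ?invr_ge0 ?nc_ge0 ?(ltW rho0) //.
  by rewrite ncM ncV ler_wpM2r // invr_ge0 nc_ge0.
move: (4 * nc zeta ^+ n.+1) (4 * rho ^+ n.+1 * _) => x y xy; rewrite ler_norml /h => /andP[? ?].
by apply/andP; split; lra.
Qed.

End Potential.

(** * Uniform growth of log potentials *)
Section NonConcentration.
Context d (T : measurableType d) (R : realType) (P : probability T R).
Variable X : T -> R.
Hypothesis mX : measurable_fun setT X.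

(** The number of dyadic scales [2^-j] at which [x] is close to [t], a
    bound up to constants for the positive part of [- ln |t - x|] whose integral
    in [t] is immediate. *)
Definition proximity (t x : R) : \bar R :=
  (\sum_(j <oo) (\1_[set y : R | `|t - y| < 2 / (2 ^ j.+1)%:R] x)%:E)%E.

Lemma proximity_ge0 t x : (0 <= proximity t x)%E.
Proof. by apply: nneseries_ge0 => j _ _; rewrite lee_fin. Qed.

(** For each [x] the integral of [proximity t x] over [t] is at most
    [\sum_j 2 * 2^-j = 4]. By Tonelli's theorem the average over an interval of
    length [1] of [E (proximity t X)] is at most [4], hence it is at most [5] at
    some point. *)
Lemma exists_not_concentrated (c : R) :
  exists2 t, c <= t <= c + 1 & (\int[P]_w proximity t (X w) <= 5%:E)%E.
Proof.
pose D : set R := `[c, c + 1]%classic.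
pose A j : set (R * T) := [set p | D p.1 /\ `|p.1 - X p.2| < 2 / (2 ^ j.+1)%:R].
have mA j : measurable (A j).
  have m1 : measurable_fun setT (fun p : R * T => p.1) by exact: measurable_fst.
  have m2 : measurable_fun setT (fun p : R * T => `|p.1 - X p.2|).
    apply: measurableT_comp => //; apply: measurable_funB => //.
    by apply: measurableT_comp => //; exact: measurable_snd.
  rewrite (_ : A j = ((fun p : R * T => p.1) @^-1` D) `&`
     ((fun p : R * T => `|p.1 - X p.2|) @^-1` `]-oo, 2 / (2 ^ j.+1)%:R[%classic)).
    apply: measurableI.
      by have := m1 measurableT _ (measurable_itv `[c, c + 1]); rewrite setTI.
    by have := m2 measurableT _ (measurable_itv `]-oo, 2 / (2 ^ j.+1)%:R[); rewrite setTI.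
  by apply/seteqP; split => p /=; rewrite !in_itv /=.
pose f (p : R * T) : \bar R := (\sum_(j <oo) (\1_(A j) p)%:E)%E.
have f0 p : (0 <= f p)%E by apply: nneseries_ge0 => j _ _; rewrite lee_fin.
have mf : measurable_fun setT f.
  apply: ge0_emeasurable_sum => [j p _ _|j _]; first by rewrite lee_fin.
  by apply/measurable_EFinP; exact: measurable_indic.
have inner w : (\int[@lebesgue_measure R]_t f (t, w) <= 4%:E)%E.
  have mAw j : measurable [set t | A j (t, w)].
    have := @measurable_ysection _ _ _ _ _ w (mA j).
    by rewrite ysectionE.
  have mi j : measurable_fun setT (fun t => (\1_(A j) (t, w))%:E : \bar R).
    by apply/measurable_EFinP; exact: (@measurable_indic _ _ _ setT _ (mAw j)).
  have i0 j t : setT t -> (0 <= (\1_(A j) (t, w))%:E :> \bar R)%E by rewrite lee_fin.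
  have iE := integral_nneseries (@lebesgue_measure R) measurableT mi i0.
  rewrite (_ : (\int[@lebesgue_measure R]_t f (t, w))%E
    = (\sum_(j <oo) \int[@lebesgue_measure R]_t (\1_(A j) (t, w))%:E)%E); last exact: iE.
  have e4 : (\sum_(j <oo) (4 / (2 ^ j.+1)%:R : R)%:E <= 4%:E :> \bar R)%E.
    exact: epsilon_trick0.
  refine (le_trans _ e4).
  apply: lee_nneseries => [j _ _|j _]; first by apply: integral_ge0 => t _; rewrite lee_fin.
  rewrite (_ : (fun t => (\1_(A j) (t, w))%:E) = fun t => (\1_[set t | A j (t, w)] t)%:E) //.
  rewrite (integral_indic (@lebesgue_measure R) measurableT (mAw j)) setIT.
  pose e : R := 2 / (2 ^ j.+1)%:R.
  have e0 : 0 < e by rewrite divr_gt0 // ltr0n expn_gt0.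
  apply: (@le_trans _ _ (@lebesgue_measure R `]X w - e, X w + e[%classic)).
    apply: le_measure; [rewrite inE; exact: mAw|rewrite inE; exact: measurable_itv|].
    by move=> t /= [_]; rewrite in_itv /= -/e ltr_distl.
  rewrite lebesgue_measure_itv /= lte_fin ifT; last by lra.
  rewrite -EFinB lee_fin -/e (_ : 4 / _ = 2 * e); first lra.
  by rewrite /e mulrA; congr (_ / _); lra.
have outer : (\int[@lebesgue_measure R]_t \int[P]_w f (t, w) <= 4%:E)%E.
  have fE := @fubini_tonelli _ _ _ _ R (@lebesgue_measure R) P f mf f0.
  rewrite (_ : (\int[@lebesgue_measure R]_t \int[P]_w f (t, w))%E
    = (\int[P]_w \int[@lebesgue_measure R]_t f (t, w))%E); last exact: fE.
  apply: (@le_trans _ _ (\int[P]_w (cst 4%:E w))%E).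
    apply: ge0_le_integral => //; first by move=> w _; apply: integral_ge0.
    exact: (@measurable_fun_fubini_tonelli_G _ _ _ _ R (@lebesgue_measure R) f mf f0).
  rewrite (_ : (\int[P]_w cst 4%:E w)%E = (4%:E * P setT)%E); last exact: integral_cst.
  by rewrite probability_setT mule1.
have [//|none] := pselect (exists2 t, c <= t <= c + 1 & (\int[P]_w proximity t (X w) <= 5%:E)%E).
suff : (5%:E <= 4%:E :> \bar R)%E by rewrite lee_fin; lra.
have mD : measurable D by exact: measurable_itv.
have mF := @measurable_fun_fubini_tonelli_F _ _ _ _ R P f mf f0.
have F0 t : (0 <= \int[P]_w f (t, w))%E by apply: integral_ge0.
apply: le_trans outer.
apply: (@le_trans _ _ (\int[@lebesgue_measure R]_(t in D) \int[P]_w f (t, w))%E); last first.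
  exact: ge0_subset_integral.
apply: (@le_trans _ _ (\int[@lebesgue_measure R]_(t in D) cst 5%:E t)%E).
  have lD : @lebesgue_measure R D = 1%:E.
    rewrite lebesgue_measure_itv /= lte_fin ifT ?ltrDl // -EFinB; congr EFin; lra.
  rewrite (_ : integral _ _ _ = (5%:E * @lebesgue_measure R D)%E); last exact: integral_cst.
  by rewrite lD mule1.
apply: ge0_le_integral => //.
- by move=> t _; rewrite lee_fin.
- exact: measurable_funTS.
- move=> t tD; apply/ltW; rewrite ltNge; apply/negP => le5; apply: none.
exists t; first by move: tD; rewrite /D /= in_itv.
apply: le_trans le5; rewrite le_eqVlt; apply/orP; left; apply/eqP.
apply: eq_integral => w _; apply: eq_eseriesr => j _; congr EFin.
rewrite !indicE; congr (_%:R : R); congr nat_of_bool.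
by apply/idP/idP; rewrite !inE /A /=; [move=> h; split | case].
Qed.
End NonConcentration.

Section Growth.
Variable R : realType.
Local Notation C := (Cplx R).
Local Notation Re := (@complex.Re R).
Local Notation nc := (@Normc.normc R).

Lemma proximity_ge (m : nat) (t x : R) :
  (forall j, (j < m)%N -> `|t - x| < 2 / (2 ^ j.+1)%:R) -> (m%:R%:E <= proximity t x)%E.
Proof.
move=> close; apply: (@le_trans _ _ (\sum_(0 <= j < m)
    (\1_[set y : R | `|t - y| < 2 / (2 ^ j.+1)%:R] x)%:E)%E); last first.
  by apply: nneseries_lim_ge => j _ _; rewrite lee_fin.
rewrite big_mkord (eq_bigr (fun=> 1%:E)); last first.
  by move=> j _; rewrite indicE mem_set //=; apply: close.
by rewrite sumEFin sumr_const card_ord.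
Qed.

(** If [0 < s < 1], then [m = floor (- ln s / 2) + 1] scales see the point [x], since
    [|t - x| <= exp (1 - m)] and [e > 2]. *)
Lemma neg_ln_le_proximity (t x s : R) : `|t - x| ^+ 2 <= s ->
  (maxe (- lne s%:E) 0 <= 2%:E * proximity t x)%E.
Proof.
move=> us.
have key (m : nat) : s < 1 -> (0 < m)%N -> s <= expR (- (2 * m.-1%:R)) ->
    (m%:R%:E <= proximity t x)%E.
  move=> s1 m0 sm; apply: proximity_ge => j jm.
  have jm1 : (j <= m.-1)%N by rewrite -ltnS prednK.
  have p0 : 0 < (2 ^ j)%:R :> R by rewrite ltr0n expn_gt0.
  have -> : 2 / (2 ^ j.+1)%:R = ((2 ^ j)%:R)^-1 :> R.
    by rewrite expnS natrM invfM mulrA divff // mul1r.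
  have : s < ((2 ^ j)%:R)^-1 ^+ 2.
    case: j jm jm1 p0 => [|j] jm jm1 p0; first by rewrite expn0 invr1 expr1n.
    apply: le_lt_trans sm _.
    apply: (@le_lt_trans _ _ (expR (- (2 * j.+1%:R)))).
      by rewrite ler_expR lerN2 ler_pM2l // ler_nat.
    rewrite expRN expRM_natl exprVn ltf_pV2 ?posrE ?exprn_gt0 ?expR_gt0 //.
    rewrite ltr_pXn2r ?nnegrE ?expR_ge0 ?(ltW p0) // natrX -[j.+1%:R]mulr1 expRM_natl.
    have h := expR_gt1Dx (oner_neq0 R).
    by rewrite ltr_pXn2r ?nnegrE ?expR_ge0 //; lra.
  move=> sj; rewrite -ltr_sqr ?nnegrE ?invr_ge0 ?(ltW p0) //.
  exact: le_lt_trans us sj.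
have s0 : 0 <= s by apply: le_trans us; apply: sqr_ge0.
have p0 : (0 <= 2%:E * proximity t x)%E by rewrite mule_ge0 ?proximity_ge0 ?lee_fin.
have [s1|s1] := leP 1 s.
  by rewrite ge_max p0 andbT (le_trans _ p0) // oppe_le0 lne_ge0 lee_fin.
have [s00|sp] := eqVneq s 0.
  suff -> : proximity t x = +oo%E by rewrite gt0_muley ?lte_fin // leey.
  apply/eq_infty => r.
  apply: le_trans (key (Num.truncn `|r|).+1 _ _ _) => //.
    by rewrite lee_fin (le_trans (ler_norm r)) // ltW // truncnS_gt.
  by rewrite s00 expR_ge0.
have sgt : 0 < s by rewrite lt_neqAle eq_sym sp.
rewrite ge_max p0 andbT lne_EFin //.
pose y := - ln s / 2.
have y0 : 0 < y by rewrite divr_gt0 // oppr_gt0 ln_lt0 // sgt.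
pose m := (Num.truncn y).+1.
have ym : y < m%:R by exact: truncnS_gt.
have my : m.-1%:R <= y by rewrite /m /= truncn_le ltW.
apply: (@le_trans _ _ (2%:E * m%:R%:E)%E).
  by rewrite -EFinN -EFinM lee_fin; move: ym; rewrite /y; lra.
rewrite lee_pmul2l ?fin_numE ?lte_fin //; apply: key => //.
rewrite -[leLHS](lnK sgt) ler_expR; move: my; rewrite /y; lra.
Qed.

(** [|z - w| <= |z - t| + |t - w|], and [a + b <= (1 + a) max (b, 1)]. *)
Lemma lne_normsq_le (z w t : C) :
  (lne ((nc (z - w) ^+ 2)%:E) <=
   (2 * ln (1 + nc (z - t)))%:E + maxe (lne ((nc (t - w) ^+ 2)%:E)) 0)%E.
Proof.
set a := nc (z - t); set b := nc (t - w).
have a0 : 0 <= a by apply: nc_ge0.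
have b0 : 0 <= b by apply: nc_ge0.
have zw : nc (z - w) <= a + b.
  by apply: le_trans (ncD _ _); rewrite addrA subrK.
have [->|n0] := eqVneq (nc (z - w)) 0; first by rewrite expr0n le0_lneNy // leNye.
have npos : 0 < nc (z - w) by rewrite lt_neqAle eq_sym n0 nc_ge0.
have a1 : 0 < 1 + a by lra.
have ln2 (x : R) : 0 < x -> ln (x ^+ 2) = 2 * ln x.
  by move=> x0; rewrite expr2 lnM ?posrE //; lra.
rewrite lne_EFin ?exprn_gt0 // ln2 //.
have [b1|b1] := leP 1 b.
  have bpos : 0 < b by lra.
  apply: (@le_trans _ _ ((2 * ln (1 + a))%:E + lne ((b ^+ 2)%:E))%E); last first.
    by rewrite leeD2l // le_max lexx.
  rewrite lne_EFin ?exprn_gt0 // ln2 // -EFinD lee_fin -mulrDr ler_pM2l // -lnM ?posrE //.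
  rewrite ler_ln ?posrE ?mulr_gt0 //; apply: le_trans zw _; nra.
apply: (@le_trans _ _ ((2 * ln (1 + a))%:E + 0)%E); last first.
  by rewrite leeD2l // le_max lexx orbT.
by rewrite adde0 lee_fin ler_pM2l // ler_ln ?posrE //; lra.
Qed.

(** The integral of the negative part of [ln |t - w|^2] is at most [2 * 5] by
    non-concentration. Hence the integral of its positive part exceeds the
    potential at [t] by at most [10], and it controls the positive part at [z]. *)
Lemma log_potential_growth (mu : probability (Cborel R) R) (K t : R) (z : C) :
  (\int[mu]_w proximity t (Re w) <= 5%:E)%E ->
  log_potential mu (t%:C%C : C) \is a fin_num ->
  fine (log_potential mu (t%:C%C : C)) <= K ->
  log_potential mu z \is a fin_num ->
  fine (log_potential mu z) <= K + 10 + 2 * ln (1 + nc (z - t%:C%C)).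
Proof.
move=> prox ft tK fz.
pose f (w : Cborel R) := lne ((nc ((t%:C%C : C) - (w : C)) ^+ 2)%:E).
have mf : measurable_fun setT f by exact: measurable_lne_normsq.
have mprox : measurable_fun setT (fun w : Cborel R => proximity t (Re w)).
  apply: ge0_emeasurable_sum => [j p _ _|j _]; first by rewrite lee_fin.
  apply/measurable_EFinP; apply: measurableT_comp; last exact: measurable_Re.
  apply: measurable_indic.
  rewrite (_ : [set y | _] = `]t - 2 / (2 ^ j.+1)%:R, t + 2 / (2 ^ j.+1)%:R[%classic).
    exact: measurable_itv.
  by apply/seteqP; split => y /=; rewrite in_itv /= distrC ltr_distl.
have neg : (\int[mu]_w f^\- w <= 10%:E)%E.
  apply: (@le_trans _ _ (\int[mu]_w (2%:E * proximity t (Re w)))%E).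
    apply: ge0_le_integral => //.
    - exact: measurable_funeneg.
    - by apply: measurable_funeM.
    - move=> w _; rewrite funenegE; apply: neg_ln_le_proximity.
      have e : t - Re w = Re ((t%:C%C : C) - (w : C)) by rewrite CReD CReN.
      rewrite e lerXn2r ?nnegrE ?nc_ge0 //; exact: normr_Re_le.
  rewrite ge0_integralZl //; last by move=> w _; apply: proximity_ge0.
  apply: (@le_trans _ _ (2%:E * 5%:E)%E); first by rewrite lee_pmul2l ?lte_fin.
  by rewrite -EFinM lee_fin; lra.
have neg0 : (0 <= \int[mu]_w f^\- w)%E by apply: integral_ge0.
have negfin : (\int[mu]_w f^\- w)%E \is a fin_num.
  by rewrite ge0_fin_numE // (le_lt_trans neg) // ltry.
have fE : log_potential mu (t%:C%C : C) = (\int[mu]_w f^\+ w - \int[mu]_w f^\- w)%E.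
  exact: integralE.
have pos : (\int[mu]_w f^\+ w <= (K + 10)%:E)%E.
  have -> : (\int[mu]_w f^\+ w = log_potential mu (t%:C%C : C) + \int[mu]_w f^\- w)%E.
    by rewrite fE subeK.
  by rewrite EFinD leeD // -(fineK ft) lee_fin.
pose g (w : Cborel R) := lne ((nc (z - (w : C)) ^+ 2)%:E).
have mg : measurable_fun setT g by exact: measurable_lne_normsq.
pose c := 2 * ln (1 + nc (z - (t%:C%C : C))).
have c0 : 0 <= c by rewrite mulr_ge0 // ln_ge0 // lerDl nc_ge0.
rewrite -lee_fin fineK //.
have -> : log_potential mu z = (\int[mu]_w g^\+ w - \int[mu]_w g^\- w)%E by exact: integralE.
apply: (@le_trans _ _ (\int[mu]_w g^\+ w)%E).
  by rewrite -[leRHS]sube0 leeB // integral_ge0.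
apply: (@le_trans _ _ (\int[mu]_w (c%:E + f^\+ w))%E).
  apply: ge0_le_integral => //.
  - exact: measurable_funepos.
  - by apply: emeasurable_funD => //; exact: measurable_funepos.
  - move=> w _; rewrite !funeposE ge_max; apply/andP; split; first exact: lne_normsq_le.
    by rewrite adde_ge0 ?lee_fin // le_max lexx orbT.
rewrite ge0_integralD //; last exact: measurable_funepos.
rewrite addeC EFinD; apply: leeD => //.
rewrite (_ : integral _ _ _ = (c%:E * mu setT)%E); last exact: integral_cst.
by rewrite probability_setT mule1.
Qed.
End Growth.

(** * The equation along a segment and its maximum principle *)
Section PdeAlongLines.
Variable R : realType.
Local Notation C := (Cplx R).
Local Notation Re := (@complex.Re R).
Local Notation Im := (@complex.Im R).
Local Notation nc := (@Normc.normc R).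
Local Notation E3 := ((R * R) * R)%type.

Definition zc (x : R * R) : C := (x.1 +i* x.2)%C.

Lemma rdiff_fst1 (q v : E3) : rdiff q v (fun x => x.1.1) v.1.1.
Proof.
have l : linear (fun x : E3 => x.1.1 : R) by move=> a [[? ?] ?] [[? ?] ?].
pose f : {linear E3 -> R} := HB.pack (fun x : E3 => x.1.1 : R) (GRing.isLinear.Build _ _ _ _ _ l).
have cf : continuous f.
  move=> x; apply: (@cvg_comp _ _ _ fst fst _ (nbhs x.1)); exact: cvg_fst.
split; first exact: (@linear_differentiable _ _ _ f).
rewrite deriveE; last exact: (@linear_differentiable _ _ _ f).
by rewrite (@diff_lin _ _ _ f).
Qed.

Lemma rdiff_snd1 (q v : E3) : rdiff q v (fun x => x.1.2) v.1.2.
Proof.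
have l : linear (fun x : E3 => x.1.2 : R) by move=> a [[? ?] ?] [[? ?] ?].
pose f : {linear E3 -> R} := HB.pack (fun x : E3 => x.1.2 : R) (GRing.isLinear.Build _ _ _ _ _ l).
have cf : continuous f.
  move=> x; apply: (@cvg_comp _ _ _ fst snd _ (nbhs x.1)); [exact: cvg_fst | exact: cvg_snd].
split; first exact: (@linear_differentiable _ _ _ f).
rewrite deriveE; last exact: (@linear_differentiable _ _ _ f).
by rewrite (@diff_lin _ _ _ f).
Qed.

Lemma rdiff_snd (q v : E3) : rdiff q v (fun x => x.2) v.2.
Proof.
have l : linear (fun x : E3 => x.2 : R) by move=> a [[? ?] ?] [[? ?] ?].
pose f : {linear E3 -> R} := HB.pack (fun x : E3 => x.2 : R) (GRing.isLinear.Build _ _ _ _ _ l).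
have cf : continuous f by move=> x; exact: cvg_snd.
split; first exact: (@linear_differentiable _ _ _ f).
rewrite deriveE; last exact: (@linear_differentiable _ _ _ f).
by rewrite (@diff_lin _ _ _ f).
Qed.

Lemma cdiff_zc (q v : E3) : cdiff q v (fun x => zc x.1) (zc v.1).
Proof. by split; [exact: rdiff_fst1 | exact: rdiff_snd1]. Qed.

Lemma cdiff_time (q v : E3) (h : C) : cdiff q v (fun x => (x.2)%:C%C * h : C) ((v.2)%:C%C * h).
Proof.
have ct : cdiff q v (fun x : E3 => (x.2)%:C%C : C) ((v.2)%:C%C : C).
  by split; [exact: (rdiff_snd q v) | exact: rdiff_cst].
apply: cdiff_eq; first exact: cdiffM ct (cdiff_cst _ _ h).
by rewrite mulr0 add0r mulrC.
Qed.

(** With [p = dS/dz], realness of [S] gives [dS = 2 Re (p dz + (dS/dtau) dtau)],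
    and the PDE replaces [dS/dtau] by [p^2 / 2]. *)
Lemma potential_pde_deriv (mu : C -> probability (Cborel R) R) (z tau : C) :
  potential_pde mu z tau -> exists p : C, forall v : (R * R) * (R * R),
    rdiff ((Re z, Im z), (Re tau, Im tau)) v (potential_coord mu)
      (2 * Re (p * zc v.1) + Re (p ^+ 2 * zc v.2)).
Proof.
move=> [_]; set S := potential_coord mu; set q := (_, _) => dS.
rewrite /wirtinger_tau /wirtinger_z; set D1 := 'D_(1, 0, (0, 0)) S q.
set D2 := 'D_(0, 1, (0, 0)) S q; set D3 := 'D_(0, 0, (1, 0)) S q.
set D4 := 'D_(0, 0, (0, 1)) S q => pde.
have [p [rp ip p2]] : exists p : C,
    [/\ Re p = 2^-1 * D1, Im p = - (2^-1 * D2) & p ^+ 2 = (D3 -i* D4)%C].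
  have half : (2^-1 : C) = (2^-1 : R)%:C%C by rewrite fmorphV rmorph_nat.
  have n2 : (2 : C) != 0 by rewrite pnatr_eq0.
  exists (2^-1 * (D1 -i* D2)%C); split; rewrite ?half ?CReMr ?CImMr ?mulrN //.
  by rewrite -half; apply: (@mulfI _ (2^-1 : C)); rewrite ?invr_eq0 // -pde.
exists p => v; split=> //.
have vE : v = v.1.1 *: ((1, 0), (0, 0)) + v.1.2 *: ((0, 1), (0, 0))
   + v.2.1 *: ((0, 0), (1, 0)) + v.2.2 *: ((0, 0), (0, 1)) :> (R * R) * (R * R).
  case: v => [[a b] [c d]].
  transitivity ((a * 1 + b * 0 + c * 0 + d * 0, a * 0 + b * 1 + c * 0 + d * 0),
    (a * 0 + b * 0 + c * 1 + d * 0, a * 0 + b * 0 + c * 0 + d * 1)) => //.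
  by rewrite !mulr0 !mulr1 !addr0 !add0r.
have -> : 'D_v S q = v.1.1 * D1 + v.1.2 * D2 + v.2.1 * D3 + v.2.2 * D4.
  by rewrite deriveE // {1}vE !linearD !linearZ /= -!deriveE.
rewrite p2 !CReM.
rewrite rp ip /zc /=; lra.
Qed.

Lemma derive_at_max (E : normedModType R) (q v : E) (W : E -> R) (d eta : R) :
  rdiff q v W d -> 0 < eta ->
  (forall t, 0 < t < eta -> W (t *: v + q) <= W q) -> d <= 0.
Proof.
move=> [dW dE] eta0 Wmax; rewrite leNgt; apply/negP => d0.
have dv : derivable W q v := diff_derivable dW.
move: d0; rewrite -dE => d0.
have := cvgr_gt _ dv _ d0; rewrite /dnbhs /= => near0.
have [e /= e0 eP] : exists2 e : R, 0 < e & forall t, 0 < t < e ->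
    0 < t^-1 *: ((W \o shift q) (t *: v) - W q).
  move: near0; rewrite near_withinE => near1.
  have near2 : nbhs (0 : R)
      [set t : R | t != 0 -> 0 < t^-1 *: ((W \o shift q) (t *: v) - W q)] :=
      near1 (within_filter _ (nbhs_filter _)).
  have [e /= e0 eP] := proj1 (@nbhs_ballP R R _ _) near2.
  exists e => // t /andP[t0 te].
  apply: eP; last by rewrite gt_eqF.
  by rewrite -ball_normE /= sub0r normrN gtr0_norm.
pose t := Num.min e eta / 2.
have m0 : 0 < Num.min e eta by rewrite lt_min e0.
have t0 : 0 < t by rewrite divr_gt0.
have tm : t < Num.min e eta by rewrite /t; lra.
have /andP[te teta] : (t < e) && (t < eta) by rewrite -lt_min.
have := eP t; rewrite t0 te => /(_ isT) /=; apply/negP; rewrite -leNgt.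
by rewrite /GRing.scale /= pmulr_rle0 ?invr_gt0 // subr_le0 Wmax // t0.
Qed.

(** The chain rule along [tau + s h], the third coordinate being [s]. *)
Lemma rdiff_along (mu : C -> probability (Cborel R) R) (tau h : C) (q : E3) :
  potential_pde mu (zc q.1) (tau + (q.2)%:C%C * h) ->
  exists p : C, forall v : E3,
    rdiff q v (fun x : E3 => potential_coord mu
                 (x.1, (Re tau + x.2 * Re h, Im tau + x.2 * Im h)))
      (2 * Re (p * zc v.1) + v.2 * Re (p ^+ 2 * h)).
Proof.
move=> /potential_pde_deriv [p pP]; exists p => v.
pose A (x : E3) : (R * R) * (R * R) := (x.1, (Re tau + x.2 * Re h, Im tau + x.2 * Im h)).
pose A' : (R * R) * (R * R) := (v.1, (v.2 * Re h, v.2 * Im h)).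
have qE : ((Re (zc q.1), Im (zc q.1)),
    (Re (tau + (q.2)%:C%C * h), Im (tau + (q.2)%:C%C * h))) = A q.
  by rewrite /A CReD CImD CReMr CImMr /zc /=; case: (q.1).
have [dS DS] := pP A'; rewrite qE in dS DS.
have dx1 (x : E3) : differentiable (fun x : E3 => x.1) x.
  rewrite (_ : (fun x : E3 => x.1) = (fun x : E3 => (x.1.1, x.1.2))); last first.
    by apply/funext => -[[? ?] ?].
  by apply: differentiable_pair; [case: (rdiff_fst1 x x) | case: (rdiff_snd1 x x)].
have dA : differentiable A q.
  apply: differentiable_pair; first exact: dx1.
  have lin a b : differentiable (fun x : E3 => a + x.2 * b) q.
    by case: (rdiffD (rdiff_cst q v a) (rdiffM (rdiff_snd q v) (rdiff_cst q v b))).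
  by apply: differentiable_pair; exact: lin.
split; first exact: (differentiable_comp dA dS).
have Alin t : A (t *: v + q) = t *: A' + A q.
  rewrite /A /A'; case: (q) => [[a b] s]; case: (v) => [[a' b'] s'].
  transitivity ((t * a' + a, t * b' + b),
    (Re tau + (t * s' + s) * Re h, Im tau + (t * s' + s) * Im h)) => //.
  transitivity ((t * a' + a, t * b' + b),
    (t * (s' * Re h) + (Re tau + s * Re h), t * (s' * Im h) + (Im tau + s * Im h))) => //.
  by congr (_, (_, _)); ring.
have quot : (fun t : R => t^-1 *: (((potential_coord mu \o A) \o shift q) (t *: v)
      - (potential_coord mu \o A) q)) =
    (fun t : R => t^-1 *: ((potential_coord mu \o shift (A q)) (t *: A')
      - potential_coord mu (A q))).
  by apply/funext => t /=; rewrite Alin.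
transitivity ('D_A' (potential_coord mu) (A q)); first by rewrite /derive -quot.
rewrite DS /A' /=; congr (_ + _).
by rewrite /zc /= !CReM /=; ring.
Qed.

(** At a positive interior maximum of [F - Theta] the gradients in [z] of [F]
    and [Theta] agree, so both time derivatives are compared with the same
    [Re (V^2 h)]: that of [F] equals it and that of [Theta] is strictly larger,
    although [F - Theta] cannot decrease towards the maximum. The last time
    [s = 1] is allowed, since only earlier times are used. *)
Lemma comparison (rho1 rho2 : R) (h : C) (F Theta : E3 -> R) (V : E3 -> C) (T : E3 -> R) :
  let Dom (q : E3) := rho1 <= nc (zc q.1) <= rho2 /\ 0 <= q.2 <= 1 in
  (forall q, Dom q -> exists p : C, forall v : E3,
     rdiff q v F (2 * Re (p * zc v.1) + v.2 * Re (p ^+ 2 * h))) ->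
  (forall q, Dom q -> forall v : E3, rdiff q v Theta (2 * Re (V q * zc v.1) + v.2 * T q)) ->
  (forall q, Dom q -> Re (V q ^+ 2 * h) < T q) ->
  (forall q, Dom q -> q.2 = 0 \/ nc (zc q.1) = rho1 \/ nc (zc q.1) = rho2 -> F q <= Theta q) ->
  forall q, Dom q -> F q <= Theta q.
Proof.
move=> Dom dF dTheta super bdry q0 Dq0; rewrite leNgt; apply/negP => gt0.
pose W q := F q - Theta q.
have dW q : Dom q -> exists p : C, forall v : E3, rdiff q v W
    (2 * Re ((p - V q) * zc v.1) + v.2 * (Re (p ^+ 2 * h) - T q)).
  move=> Dq; have [p pP] := dF q Dq; exists p => v.
  apply: rdiff_eq; first exact: rdiffB (pP v) (dTheta q Dq v).
  by rewrite mulrBl CReD CReN; ring.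
have cDom : compact [set q : E3 | Dom q].
  have cg : continuous (fun q : E3 => nc (zc q.1)).
    move=> q; have -> : (fun q : E3 => nc (zc q.1)) =
        (@Num.sqrt R \o (fun q : E3 => nc (zc q.1) ^+ 2)).
      by apply/funext => x /=; rewrite -/(nc (zc x.1)) sqrtr_sqr ger0_norm ?nc_ge0.
    apply: continuous_comp; last exact: sqrt_continuous.
    by apply: differentiable_continuous; case: (rdiff_normsq (cdiff_zc q q)).
  have -> : [set q : E3 | Dom q] =
      ((`[- rho2, rho2]%classic `*` `[- rho2, rho2]%classic) `*` `[0, 1]%classic)
      `&` (fun q : E3 => nc (zc q.1)) @^-1` `[rho1, rho2]%classic.
    apply/seteqP; split => [q [r12 s01]|q [[_ s01] r12]]; last first.
      by split; [move: r12 | move: s01]; rewrite /= in_itv.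
    have /andP[_ le2] := r12.
    split; last by rewrite /= in_itv.
    split; last by rewrite /= in_itv.
    split; rewrite /= in_itv /= -ler_norml.
      exact: le_trans (normr_Re_le (zc q.1)) le2.
    exact: le_trans (normr_Im_le (zc q.1)) le2.
  apply: compact_closedI.
    by apply: compact_setX; [apply: compact_setX|]; exact: segment_compact.
  by apply: closed_comp; [move=> q _; exact: cg | exact: interval_closed].
have [q qin qmax] : exists2 q, q \in [set q : E3 | Dom q] &
    forall t, t \in [set q : E3 | Dom q] -> W t <= W q.
  apply: compact_EVT_max => //; first by exists q0.
  apply: continuous_in_subspaceT => q /set_mem Dq; have [p pP] := dW q Dq.
  by apply: differentiable_continuous; case: (pP q).
have Dq : Dom q by rewrite inE in qin.
have {}qmax q' : Dom q' -> W q' <= W q by move=> Dq'; apply: qmax; rewrite inE.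
have Wpos : 0 < W q by apply: lt_le_trans (qmax _ Dq0); rewrite /W subr_gt0.
have s0 : q.2 != 0.
  by apply/eqP => q20; have := bdry q Dq (or_introl q20);
    move: Wpos; rewrite /W subr_gt0 ltNge => /negP.
have r1 : nc (zc q.1) != rho1.
  by apply/eqP => e; have := bdry q Dq (or_intror (or_introl e));
    move: Wpos; rewrite /W subr_gt0 ltNge => /negP.
have r2 : nc (zc q.1) != rho2.
  by apply/eqP => e; have := bdry q Dq (or_intror (or_intror e));
    move: Wpos; rewrite /W subr_gt0 ltNge => /negP.
have [/andP[le1 le2] /andP[sge0 sle1]] := Dq.
have lt1 : rho1 < nc (zc q.1) by rewrite lt_neqAle eq_sym r1.
have lt2 : nc (zc q.1) < rho2 by rewrite lt_neqAle r2.
have spos : 0 < q.2 by rewrite lt_neqAle eq_sym s0.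
have [p pP] := dW q Dq.
(* Moves along t u, for t below eta, stay in the annulus. *)
have spatial (u : R * R) : Re ((p - V q) * zc u) <= 0.
  pose eta := Num.min (nc (zc q.1) - rho1) (rho2 - nc (zc q.1)) / (1 + nc (zc u)).
  have nu : 0 <= nc (zc u) by apply: nc_ge0.
  have m0 : 0 < Num.min (nc (zc q.1) - rho1) (rho2 - nc (zc q.1))
    by rewrite lt_min !subr_gt0 lt1 lt2.
  have eta0 : 0 < eta by rewrite divr_gt0 // ltr_pwDl.
  have := derive_at_max (pP (u, 0)) eta0.
  rewrite mul0r addr0 pmulr_rle0 //; apply => t /andP[t0 teta].
  apply: qmax; split; last by rewrite /= scaler0 add0r sge0.
  have zE : zc (t *: u + q.1) = t%:C%C * zc u + zc q.1.
    by apply: C_eq; rewrite ?CReD ?CImD ?CReMr ?CImMr.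
  have tu : t * nc (zc u) < Num.min (nc (zc q.1) - rho1) (rho2 - nc (zc q.1)).
    have u1 : 0 < 1 + nc (zc u) by lra.
    move: teta; rewrite /eta ltr_pdivlMr // => h1; apply: le_lt_trans h1; nra.
  have tuE : nc (t%:C%C * zc u) = t * nc (zc u) by rewrite ncM nc_real gtr0_norm.
  move: tu; rewrite lt_min => /andP[tu1 tu2].
  rewrite (_ : (t *: ((u, 0) : E3) + q).1 = t *: u + q.1) // zE; apply/andP; split.
    have := ncB (zc q.1) (- (t%:C%C * zc u)); rewrite ncN opprK tuE addrC [zc q.1 + _]addrC; lra.
  have := ncD (t%:C%C * zc u) (zc q.1); rewrite tuE; lra.
have pV : p = V q.
  apply/eqP; rewrite -subr_eq0; apply/eqP; move: (p - V q) spatial => w sp.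
  have := sp (1, 0); have := sp (-1, 0); have := sp (0, 1); have := sp (0, -1).
  rewrite !CReM /zc /= => ? ? ? ?; apply: C_eq; rewrite /=; lra.
have := derive_at_max (pP (0, -1)) spos.
rewrite pV subrr mul0r /= mulr0 add0r mulN1r oppr_le0 subr_ge0 leNgt super //.
suff h1 : forall t, 0 < t < q.2 -> W (t *: ((0, -1) : E3) + q) <= W q by move=> /(_ h1).
move=> t /andP[t0 tq]; apply: qmax; split.
  have -> : (t *: ((0, -1) : E3) + q).1 = q.1 by rewrite /= scaler0 add0r.
  by rewrite le1 le2.
have -> : (t *: ((0, -1) : E3) + q).2 = q.2 - t by rewrite /= /GRing.scale /= mulrN1 addrC.
by apply/andP; split; lra.
Qed.
End PdeAlongLines.

(** * The flow of moments as an approximate solution *)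
Section Barrier.
Variable R : realType.
Local Notation C := (Cplx R).
Local Notation Re := (@complex.Re R).
Local Notation Im := (@complex.Im R).
Local Notation nc := (@Normc.normc R).
Local Notation E3 := ((R * R) * R)%type.

Lemma horner_bound (p : {poly C}) : exists2 K : R, 0 <= K &
  forall x : C, nc x <= 1 -> nc p.[x] <= K.
Proof.
exists (\sum_(i < size p) nc p`_i); first by apply: sumr_ge0 => i _; apply: nc_ge0.
move=> x x1; rewrite horner_coef; apply: le_trans (nc_sum _ _) _.
apply: ler_sum => i _; rewrite ncM ncX ler_piMr ?nc_ge0 // exprn_ile1 ?nc_ge0 //.
Qed.

Variable m : nat -> {poly C}.
Hypothesis m0 : forall x, (m 0).[x] = 1.
Hypothesis dm : forall a, (m a)^`() =
  - (a%:R / 2%:R) *: \sum_(0 <= b < a.-1) m b * m (a - b - 2)%N.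

Lemma horners_bound (n : nat) : exists2 K : R, 0 <= K &
  forall a x, (a < n)%N -> nc x <= 1 -> nc (m a).[x] <= K.
Proof.
elim: n => [|n [K K0 IH]]; first by exists 0.
have [K' K'0 mn] := horner_bound (m n).
exists (K + K'); first exact: addr_ge0.
move=> a x; rewrite ltnS leq_eqVlt => /orP[/eqP ->|an] x1.
  by apply: le_trans (mn x x1) _; rewrite lerDr.
by apply: le_trans (IH a x an x1) _; rewrite lerDl.
Qed.

Section Profile.
Variables (k : nat) (h : C).
Let n := k.*2.+1.

(** The expansion at infinity of a log potential with moments [m a] at the
    time [s h], up to order [n]. The odd order makes the error a power of
    [|z|^-2], which is smooth away from [0]. *)
Definition profile (q : E3) : R :=
  ln (nc (zc q.1) ^+ 2)
  - 2 * Re (\sum_(a < n) (m a.+1).[(q.2)%:C%C * h] * (zc q.1)^-1 ^+ a.+1 / a.+1%:R).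

(** The formal derivative in [z]; the term [a = 0] is the derivative of the
    logarithm, as [m 0 = 1]. *)
Definition profile_z (q : E3) : C :=
  (zc q.1)^-1 * \sum_(a < n.+1) (m a).[(q.2)%:C%C * h] * (zc q.1)^-1 ^+ a.

Definition profile_t (q : E3) : R :=
  - 2 * Re (h * \sum_(a < n) (m a.+1)^`().[(q.2)%:C%C * h] * (zc q.1)^-1 ^+ a.+1 / a.+1%:R).

Lemma rdiff_profile (q v : E3) : zc q.1 != 0 ->
  rdiff q v profile (2 * Re (profile_z q * zc v.1) + v.2 * profile_t q).
Proof.
move=> z0; have dz := cdiff_zc q v; have dt := cdiff_time q v h.
have dV := cdiffV (f := fun x : E3 => zc x.1) z0 dz.
have dL := rdiff_ln_normsq (f := fun x : E3 => zc x.1) z0 dz.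
have dS := cdiff_sum (index_enum 'I_n) (fun a : 'I_n => cdiffM (cdiffM (cdiff_horner (m a.+1) dt)
   (cdiffX a.+1 dV)) (cdiff_cst q v (a.+1%:R^-1 : C))).
apply: rdiff_eq; first exact: rdiffB dL (rdiffMl 2 (proj1 dS)).
rewrite /profile_z /profile_t; set z := zc q.1 in z0 *; set x := _ * h; set u := zc v.1.
rewrite [\sum_(a < n.+1) _]big_ord_recl m0 expr0 mulr1.
set SD := \sum_(a < n) (_ : C); set S1 := \sum_(a < n) (_ : C).
set S2 := \sum_(a < n) (_ : C).
have key : u / z - SD = z^-1 * (1 + S1) * u - (v.2)%:C%C * (h * S2).
  rewrite [in RHS]mulrDr mulr1 mulrDl -[in RHS]addrA; congr (_ + _); first by rewrite mulrC.
  rewrite mulrA /SD /S1 /S2 !mulr_sumr mulr_suml -!sumrN -big_split /=.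
  apply: eq_bigr => a _; have a0 : a.+1%:R != 0 :> C by rewrite pnatr_eq0.
  rewrite mulr0 add0r /bump /= add1n -(exprVn z 2).
  move: a.+1%:R a0 (z^-1) => a1 a0 y; rewrite !exprS expr0.
  move: (y ^+ a) (m a.+1).[x] (m a.+1)^`().[x] => w M M'.
  by field.
transitivity (2 * Re (u / z - SD)); first by rewrite CReD CReN; ring.
by rewrite key CReD CReN CReMr; ring.
Qed.

Lemma nc_real_mul_le1 (s : R) : nc h <= 1 -> 0 <= s <= 1 -> nc (s%:C%C * h) <= 1.
Proof.
by move=> h1 /andP[s0 s1]; rewrite ncM nc_real ger0_norm // mulr_ile1 // nc_ge0.
Qed.

(** The generating polynomial of the moments, for which the hierarchy is a
    statement about coefficients of the square. *)
Definition truncation (x : C) : {poly C} := \poly_(a < n.+1) (m a).[x].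

Lemma profile_zE q : profile_z q =
  (zc q.1)^-1 * (truncation ((q.2)%:C%C * h)).[(zc q.1)^-1].
Proof. by rewrite /profile_z horner_poly. Qed.

(** The hierarchy says that the time derivative of the profile consists of the
    terms of low degree of the square of its [z]-derivative. *)
Lemma profile_tE q : profile_t q = Re (h * ((zc q.1)^-1 ^+ 2 *
  (take_poly k.*2 (truncation ((q.2)%:C%C * h) ^+ 2)).[(zc q.1)^-1])).
Proof.
rewrite /profile_t; set x := _ * h; set y := (zc q.1)^-1.
have double (w : C) : - 2 * Re w = Re (- (w + w)) by rewrite CReN CReD; ring.
rewrite double -mulrDr -mulrN; congr (Re (_ * _)).
rewrite /n big_ord_recl /= dm /= big_geq // scaler0 horner0 !mul0r add0r.
rewrite horner_poly -big_split -sumrN mulr_sumr /=; apply: eq_bigr => i _.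
rewrite /bump /= add1n dm hornerZ horner_sum big_mkord /=.
rewrite expr2 coef_polyM; last by rewrite (leq_trans (ltn_ord i)) // leqW.
have -> : \sum_(b < i.+1) (m b * m (i.+2 - b - 2)%N).[x]
    = \sum_(b < i.+1) (m b).[x] * (m (i - b)%N).[x].
  by apply: eq_bigr => b _; rewrite hornerM subnAC subn2.
have i0 : i.+2%:R != 0 :> C by rewrite pnatr_eq0.
move: i.+2%:R i0 (\sum_(b < i.+1) _) => d d0 S; rewrite !exprS ?expr0; move: (y ^+ i) => w.
by field.
Qed.
End Profile.

Lemma horner_le (p : {poly C}) (d : nat) (c : R) (y : C) : (size p <= d)%N ->
  (forall i, nc p`_i <= c) -> nc y <= 1 -> nc p.[y] <= d%:R * c.
Proof.
move=> sp pc y1; rewrite (horner_coef_wide _ sp); apply: le_trans (nc_sum _ _) _.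
apply: (@le_trans _ _ (\sum_(i < d) c)); last by rewrite sumr_const card_ord mulr_natl.
apply: ler_sum => i _; rewrite ncM ncX; apply: le_trans (pc i).
by rewrite ler_piMr ?nc_ge0 // exprn_ile1 ?nc_ge0.
Qed.

(** What remains of the square are its terms of degree at least [2 k] in
    [1/z], apart from the factor [z^-2]. *)
Lemma profile_residual (k : nat) : exists C0 C1 : R, [/\ 0 <= C0, 0 <= C1 &
  forall (h : C) (q : E3), nc h <= 1 -> 1 <= nc (zc q.1) -> 0 <= q.2 <= 1 ->
    nc (profile_z k h q) <= C1 * (nc (zc q.1))^-1 /\
    Re (profile_z k h q ^+ 2 * h) <=
      profile_t k h q + nc h * (C0 * (nc (zc q.1) ^+ 2)^-1 ^+ k.+1)].
Proof.
have [K K0 mK] := horners_bound k.*2.+2.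
(* d bounds the sizes of T and T ^+ 2, and c the coefficients of T ^+ 2. *)
pose d := k.*2.+2.*2.
pose c := d%:R * (K * K).
have c0 : 0 <= c by rewrite mulr_ge0 ?mulr_ge0.
exists (d%:R * c), (d%:R * K); split; [by rewrite mulr_ge0 | by rewrite mulr_ge0 |].
move=> h q h1 z1 s01; set y := (zc q.1)^-1.
have y1 : nc y <= 1 by rewrite ncV invf_le1 // (lt_le_trans _ z1).
have x1 := nc_real_mul_le1 h1 s01; set x := _ * h in x1.
pose T := truncation k x.
have T1 i : nc T`_i <= K.
  by rewrite coef_poly; case: ltnP => [lt|_]; [exact: mK | rewrite nc0].
have sT : (size T <= k.*2.+2)%N by exact: size_poly.
have sT' : (size T <= d)%N by rewrite (leq_trans sT) // /d -(addnn k.*2.+2) leq_addr.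
have sT2 : (size (T ^+ 2) <= d)%N.
  rewrite expr2 (leq_trans (size_polyMleq _ _)) // (leq_trans (leq_pred _)) //.
  by rewrite /d -(addnn k.*2.+2) leq_add.
have T2 i : nc (T ^+ 2)`_i <= c.
  case: (ltnP i d) => [lt|le]; last by rewrite nth_default ?nc0 // (leq_trans sT2).
  rewrite expr2 coefM; apply: le_trans (nc_sum _ _) _.
  apply: (@le_trans _ _ (\sum_(b < i.+1) K * K)).
    by apply: ler_sum => b _; rewrite ncM ler_pM ?nc_ge0.
  by rewrite sumr_const card_ord -[leLHS]mulr_natl ler_wpM2r ?mulr_ge0 // ler_nat.
rewrite profile_zE profile_tE -/y -/x -/T; split.
  by rewrite ncM -ncV mulrC ler_wpM2r ?nc_ge0 //; exact: horner_le.
have -> : (y * T.[y]) ^+ 2 * h = h * (y ^+ 2 * (take_poly k.*2 (T ^+ 2)).[y])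
    + h * (y ^+ 2 * y ^+ k.*2 * (drop_poly k.*2 (T ^+ 2)).[y]).
  have := congr1 (horner^~ y) (poly_take_drop k.*2 (T ^+ 2)).
  rewrite hornerD hornerM hornerXn horner_exp => e; rewrite exprMn -e; ring.
rewrite CReD lerD2l; apply: le_trans (Re_le_nc _) _.
rewrite ncM ler_wpM2l ?nc_ge0 // -exprD ncM ncX mulrC.
have -> : nc y ^+ (2 + k.*2) = (nc (zc q.1) ^+ 2)^-1 ^+ k.+1.
  by rewrite ncV -exprVn -exprM mulnS mul2n.
rewrite ler_wpM2r ?exprn_ge0 ?invr_ge0 ?sqr_ge0 //.
apply: horner_le => // [|i]; last by rewrite coef_drop_poly.
by rewrite size_drop_poly (leq_trans (leq_subr _ _)).
Qed.

(** The factor [1 + s] makes the correction grow in time, which absorbs the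
    residual of the profile; [A] takes care of the inner circle and of the
    initial error, [delta] of the growth at infinity. *)
Definition barrier (k : nat) (A delta : R) (h : C) (q : E3) : R :=
  profile k h q + (1 + q.2) *
    (A * (nc (zc q.1) ^+ 2)^-1 ^+ k.+1 + delta * nc (zc q.1) ^+ 2).

(** [|z|^2] has derivative [z^*] in [z]. *)
Definition barrier_z (k : nat) (A delta : R) (h : C) (q : E3) : C :=
  profile_z k h q + ((1 + q.2) *
    (delta - k.+1%:R * A * (nc (zc q.1) ^+ 2)^-1 ^+ k.+2))%:C%C * (zc q.1)^*%C.

Definition barrier_t (k : nat) (A delta : R) (h : C) (q : E3) : R :=
  profile_t k h q +
    (A * (nc (zc q.1) ^+ 2)^-1 ^+ k.+1 + delta * nc (zc q.1) ^+ 2).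

Lemma rdiff_barrier k A delta h (q v : E3) : zc q.1 != 0 ->
  rdiff q v (barrier k A delta h)
    (2 * Re (barrier_z k A delta h q * zc v.1) + v.2 * barrier_t k A delta h q).
Proof.
move=> z0; have dN := rdiff_normsq (cdiff_zc q v).
have N0 : nc (zc q.1) ^+ 2 != 0 by rewrite expf_neq0 // nc_eq0.
have dI := rdiffX k.+1 (rdiffV (f := fun x : E3 => nc (zc x.1) ^+ 2) N0 dN).
have d1 := rdiffD (rdiff_cst q v 1) (rdiff_snd q v).
apply: rdiff_eq.
  exact: rdiffD (rdiff_profile k h v z0) (rdiffM d1 (rdiffD (rdiffMl A dI) (rdiffMl delta dN))).
rewrite /barrier_z /barrier_t; set z := zc q.1 in N0 *; set u := zc v.1.
have conjE (b : R) : Re ((b%:C%C : C) * z^*%C * u) = b * (Re z * Re u + Im z * Im u).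
  by rewrite -mulrA CReMr CReM; case: (z) => x y /=; ring.
rewrite [(_ + _) * u]mulrDl CReD conjE /=.
move: N0; set N := nc z ^+ 2 => N0; rewrite -(exprVn N 2).
move: (profile_z _ _ _) (profile_t _ _ _) (N^-1) => pz pt I.
rewrite /= !exprS expr0; move: (I ^+ k) k.+1%:R => Ik K.
by ring.
Qed.

(** The arithmetic behind the supersolution property, with [X = |z|^(-2k-2)],
    [N = |z|^2], [np] and [nb] the norms of the gradients of the profile and of
    the correction, and [hh = |h|]. Every term on the left is at most a constant
    times [hh] times the right-hand side, uniformly in [z] and [delta]. For the
    cross term this uses that [np] decays like [1/|z|]. *)
Lemma barrier_ineq (K A delta C0 C1 X N r np nb hh : R) :
  0 <= K -> 1 <= A -> 0 < delta <= 1 -> 0 <= C0 -> 0 <= C1 -> 0 < X <= 1 ->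
  1 <= r -> N = r ^+ 2 -> 0 <= np <= C1 * r^-1 ->
  0 <= nb <= 2 * (K * A * (X / N) + delta) * r -> 0 <= hh ->
  hh * (C0 + 4 * C1 * (K + 1) + 8 * (K ^+ 2 * A + 1)) < 1 ->
  hh * (C0 * X) + hh * (2 * np * nb + nb ^+ 2) < A * X + delta * N.
Proof.
move=> K0 A1 /andP[d0 d1] C00 C10 /andP[X0 X1] r1 NE /andP[np0 npl] /andP[nb0 nbl] hh0 hL.
have r0 : 0 < r by lra.
have N1 : 1 <= N by rewrite NE exprn_ege1.
have N0 : 0 < N by lra.
set g := A * X + delta * N.
have AX0 : 0 < A * X by rewrite mulr_gt0 //; lra.
have dN0 : 0 < delta * N by rewrite mulr_gt0.
have g0 : 0 < g by rewrite addr_gt0.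
pose u := K * A * (X / N).
have XN : 0 < X / N by rewrite divr_gt0.
have XNX : X / N <= X by rewrite ler_pdivrMr // ler_peMr // ltW.
have KA : 0 <= K * A by rewrite mulr_ge0 //; lra.
have u0 : 0 <= u by rewrite mulr_ge0 // ltW.
have ug : u <= K * g.
  apply: (@le_trans _ _ (K * (A * X))); last by rewrite ler_wpM2l // /g; lra.
  by rewrite /u -mulrA ler_wpM2l // ler_wpM2l //; lra.
have dg : delta <= g.
  apply: (@le_trans _ _ (delta * N)); last by rewrite /g; lra.
  by rewrite ler_peMr // ltW.
have t2 : 2 * np * nb <= 4 * C1 * (K + 1) * g.
  have h1 : np * nb <= (C1 * r^-1) * (2 * (u + delta) * r) by rewrite ler_pM.
  have h2 : (C1 * r^-1) * (2 * (u + delta) * r) = 2 * C1 * (u + delta) by field; lra.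
  have h3 : 2 * C1 * (u + delta) <= 2 * C1 * ((K + 1) * g).
    by rewrite ler_wpM2l ?mulr_ge0 //; lra.
  rewrite h2 in h1; lra.
have t3 : nb ^+ 2 <= 8 * (K ^+ 2 * A + 1) * g.
  have h1 : nb ^+ 2 <= (2 * (u + delta) * r) ^+ 2.
    by rewrite lerXn2r ?nnegrE // (le_trans nb0).
  have h2 : (2 * (u + delta) * r) ^+ 2 <= 8 * (u ^+ 2 * N + delta ^+ 2 * N).
    have -> : (2 * (u + delta) * r) ^+ 2 = 4 * (u + delta) ^+ 2 * N by rewrite NE; ring.
    have h : (u + delta) ^+ 2 <= 2 * (u ^+ 2 + delta ^+ 2).
      have := sqr_ge0 (u - delta); lra.
    have : 4 * ((u + delta) ^+ 2 * N) <= 4 * (2 * (u ^+ 2 + delta ^+ 2) * N).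
      by rewrite ler_pM2l // ler_wpM2r // ltW.
    lra.
  have h3 : u ^+ 2 * N <= K ^+ 2 * A * g.
    have -> : u ^+ 2 * N = (K ^+ 2 * A) * (A * X * (X / N)) by rewrite /u; field; lra.
    have KA2 : 0 <= K ^+ 2 * A by rewrite mulr_ge0 ?sqr_ge0 //; lra.
    rewrite ler_wpM2l //; apply: (@le_trans _ _ (A * X)); last by rewrite /g; lra.
    by rewrite ler_piMr //; lra.
  have h4 : delta ^+ 2 * N <= g.
    apply: (@le_trans _ _ (delta * N)); last by rewrite /g; lra.
    by rewrite expr2 -mulrA ler_piMl // ltW.
  lra.
have t1 : C0 * X <= C0 * g.
  rewrite ler_wpM2l //; apply: (@le_trans _ _ (A * X)); last by rewrite /g; lra.
  by rewrite ler_peMl // ltW.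
rewrite -mulrDr; set L := C0 + _ + _ in hL.
apply: (@le_lt_trans _ _ (hh * (L * g))).
  by rewrite ler_wpM2l //; rewrite /L; lra.
by rewrite mulrA gtr_pMl.
Qed.

(** The barrier gains [A |z|^(-2k-2) + delta |z|^2] in time derivative, while
    all errors carry a factor [|h|]. *)
Lemma barrier_supersolution (k : nat) : exists C0 C1 : R, [/\ 0 <= C0, 0 <= C1 &
  forall (A delta : R) (h : C) (q : E3), 1 <= A -> 0 < delta <= 1 -> nc h <= 1 ->
    nc h * (C0 + 4 * C1 * (k.+1%:R + 1) + 8 * (k.+1%:R ^+ 2 * A + 1)) < 1 ->
    1 <= nc (zc q.1) -> 0 <= q.2 <= 1 ->
    Re (barrier_z k A delta h q ^+ 2 * h) < barrier_t k A delta h q].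
Proof.
have [C0 [C1 [C00 C10 res]]] := profile_residual k.
exists C0, C1; split=> // A delta h q A1 d01 h1 hL z1 s01.
have [pzl ptl] := res h q h1 z1 s01.
rewrite /barrier_z /barrier_t; set P := profile_z k h q in pzl ptl *.
set b := (1 + q.2) * _; set z := zc q.1 in z1 pzl ptl *; set B : C := b%:C%C * z^*%C.
have -> : (P + B) ^+ 2 * h = P ^+ 2 * h + h * (2 * P * B + B ^+ 2) by ring.
rewrite CReD; apply: le_lt_trans (lerD ptl (Re_le_nc _)) _.
rewrite -addrA ltrD2l ncM.
set N := nc z ^+ 2; set X := N^-1 ^+ k.+1.
have N1 : 1 <= N by rewrite /N exprn_ege1.
have N0 : 0 < N by lra.
have X01 : 0 < X <= 1.
  by rewrite /X exprn_gt0 ?invr_gt0 //= exprn_ile1 ?invr_ge0 ?invf_le1 // ltW.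
apply: le_lt_trans (barrier_ineq (ler0n R k.+1) A1 d01 C00 C10 X01 z1
  (erefl N) (np := nc P) (nb := nc B) _ _ (nc_ge0 h) hL).
- rewrite lerD2l ler_wpM2l ?nc_ge0 //; apply: le_trans (ncD _ _) _.
  rewrite ncX lerD2r (ncM _ B) (ncM 2 P).
  by rewrite (_ : (2 : C) = (2 : R)%:C%C) ?nc_real ?normr_nat // rmorph_nat.
- by rewrite nc_ge0 pzl.
rewrite nc_ge0 andTb /B ncM nc_real.
have -> : nc z^*%C = nc z by case: (z) => a c /=; rewrite sqrrN.
rewrite ler_wpM2r ?nc_ge0 // /b normrM.
have /andP[s0 s1] := s01; rewrite ger0_norm; last by lra.
have /andP[dl dl1] := d01; have /andP[X0 X1] := X01.
rewrite ler_pM //; [lra | lra |].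
apply: le_trans (ler_normB _ _) _; rewrite addrC (gtr0_norm dl) lerD2r.
rewrite ger0_norm; first by rewrite -/N exprSr.
have A0 : 0 <= A by lra.
apply: mulr_ge0; first exact: mulr_ge0.
by rewrite exprn_ge0 // invr_ge0 sqr_ge0.
Qed.
End Barrier.

Section MomentFlow.
Variable R : realType.
Local Notation C := (Cplx R).
Local Notation Re := (@complex.Re R).
Local Notation nc := (@Normc.normc R).
Local Notation E3 := ((R * R) * R)%type.

(** If [e a] is the first nonzero coefficient, then [z] is sent to infinity
    along the direction where [e a / z^(a + 1)] is positive, and the leading term
    of order [|z|^(-a-1)] contradicts the upper bound. *)
Lemma expansion_coef_eq0 (n : nat) (e : nat -> C) (K rho : R) :
  (forall z : C, rho <= nc z ->
     Re (\sum_(a < n) e a * z^-1 ^+ a.+1) <= K * (nc z)^-1 ^+ n.+1) ->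
  forall a, (a < n)%N -> e a = 0.
Proof.
move=> le a; elim/ltn_ind: a => a IH an; apply/eqP/negPn/negP => ea.
(* On the ray z = t / v the leading term is |e a|^2 / t^(a + 1). *)
pose v : C := a.+1.-root (e a)^*%C.
have vE : v ^+ a.+1 = (e a)^*%C by rewrite rootCK.
have v0 : v != 0 by rewrite rootC_eq0 // conjc_eq0.
have nv : 0 < nc v by rewrite nc_gt0.
have ca : Re (e a * v ^+ a.+1) = nc (e a) ^+ 2.
  by rewrite vE ncE; case: (e a) => x y /=; ring.
pose c := nc (e a) ^+ 2.
have c0 : 0 < c by rewrite exprn_gt0 // nc_gt0.
pose D := \sum_(b < n) nc (e b) * nc v ^+ b.+1 + `|K| * nc v ^+ n.+1.
have D0 : 0 <= D.
  rewrite addr_ge0 ?mulr_ge0 ?exprn_ge0 ?nc_ge0 //; apply: sumr_ge0 => b _.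
  by rewrite mulr_ge0 ?exprn_ge0 ?nc_ge0.
pose t := 1 + `|rho| * nc v + D / c.
have t1 : 1 <= t.
  have := mulr_ge0 (normr_ge0 rho) (nc_ge0 v); have := divr_ge0 D0 (ltW c0).
  by rewrite /t; lra.
have t0 : 0 < t by lra.
have tD : D < t * c.
  rewrite -ltr_pdivrMr // /t; have := mulr_ge0 (normr_ge0 rho) (nc_ge0 v); lra.
pose z : C := t%:C%C / v.
have ncz : nc z = t / nc v by rewrite ncM ncV nc_real gtr0_norm.
have zr : rho <= nc z.
  rewrite ncz ler_pdivlMr //; have := ler_norm rho; have := divr_ge0 D0 (ltW c0).
  rewrite /t => ? ?; have : rho * nc v <= `|rho| * nc v by rewrite ler_pM2r.
  lra.
have zV : z^-1 = (t^-1)%:C%C * v.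
  by rewrite /z invfM invrK fmorphV mulrC.
have nczV : (nc z)^-1 = nc v / t by rewrite ncz invf_div.
have := le z zr; rewrite nczV.
have term (b : nat) : e b * z^-1 ^+ b.+1 = (t^-1 ^+ b.+1)%:C%C * (e b * v ^+ b.+1).
  by rewrite zV exprMn rmorphXn mulrCA.
rewrite (bigD1 (Ordinal an) isT) (term (Ordinal an)) CReD CReMr ca -/c => main.
have rest : - (t^-1 ^+ a.+2 * \sum_(b < n) nc (e b) * nc v ^+ b.+1) <=
    Re (\sum_(b < n | b != Ordinal an) e b * z^-1 ^+ b.+1).
  rewrite lerNl -CReN; apply: le_trans (Re_le_nc _) _; rewrite ncN.
  rewrite big_mkcond mulr_sumr /=; apply: le_trans (nc_sum _ _) _.
  apply: ler_sum => b _; case: ifP => [ba|_]; last first.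
    rewrite nc0; apply: mulr_ge0; first by rewrite exprn_ge0 // invr_ge0 ltW.
    by apply: mulr_ge0; rewrite ?exprn_ge0 ?nc_ge0.
  have [ba'|ab|eab] := ltngtP b a.
  - by rewrite IH // mul0r nc0 mul0r mulr0.
  - rewrite term ncM nc_real ncM ncX ger0_norm ?exprn_ge0 ?invr_ge0 ?(ltW t0) //.
    rewrite ler_wpM2r ?mulr_ge0 ?exprn_ge0 ?nc_ge0 //.
    by rewrite ler_wiXn2l ?invr_ge0 ?invf_le1 // ltW.
  - by move: ba; rewrite -val_eqE /= eab eqxx.
have right : K * (nc v / t) ^+ n.+1 <= t^-1 ^+ a.+2 * (`|K| * nc v ^+ n.+1).
  apply: (@le_trans _ _ (`|K| * (nc v / t) ^+ n.+1)).
    by rewrite ler_wpM2r ?ler_norm // exprn_ge0 // divr_ge0 ?nc_ge0 // ltW.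
  rewrite expr_div_n -exprVn mulrA mulrC ler_wpM2r ?mulr_ge0 ?exprn_ge0 ?nc_ge0 //.
  by rewrite ler_wiXn2l ?invr_ge0 ?invf_le1 // ltW.
have : t^-1 ^+ a.+1 * c <= t^-1 ^+ a.+2 * D.
  rewrite /D mulrDr; lra.
have ta : 0 < t^-1 ^+ a.+1 by rewrite exprn_gt0 // invr_gt0.
rewrite (exprS _ a.+1) [t^-1 * _]mulrC -mulrA ler_pM2l // [t^-1 * D]mulrC ler_pdivlMr // => le2.
by move: tD; rewrite ltNge mulrC le2.
Qed.

Lemma deriv0_horner (F : numFieldType) (p : {poly F}) x : p^`() = 0 -> p.[x] = p.[0].
Proof.
move=> p0; have -> : p = (p`_0)%:P; last by rewrite !hornerC.
apply/polyP => -[|i]; rewrite coefC //=.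
have := congr1 (fun q : {poly F} => q`_i) p0.
by rewrite coef_deriv coef0 => /eqP; rewrite mulrn_eq0 /= => /eqP.
Qed.

Lemma profile_ge (m : nat -> {poly C}) (k : nat) : exists2 D : R, 0 <= D &
  forall (h : C) (q : E3), nc h <= 1 -> 1 <= nc (zc q.1) -> 0 <= q.2 <= 1 ->
    - D <= profile m k h q.
Proof.
have [K K0 mK] := horners_bound m k.*2.+3.
exists (2 * \sum_(a < k.*2.+1) K); first by rewrite mulr_ge0 // sumr_ge0.
move=> h q h1 z1 s01; rewrite /profile.
have l0 : 0 <= ln (nc (zc q.1) ^+ 2) by rewrite ln_ge0 // exprn_ege1.
suff : Re (\sum_(a < k.*2.+1) (m a.+1).[(q.2)%:C%C * h] * (zc q.1)^-1 ^+ a.+1 / a.+1%:R)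
    <= \sum_(a < k.*2.+1) K by lra.
apply: le_trans (Re_le_nc _) _; apply: le_trans (nc_sum _ _) _; apply: ler_sum => a _.
have y1 : nc (zc q.1)^-1 <= 1 by rewrite ncV invf_le1 // (lt_le_trans _ z1).
have a1 : nc (a.+1%:R^-1 : C) <= 1.
  have -> : (a.+1%:R : C) = (a.+1%:R : R)%:C%C by rewrite rmorph_nat.
  by rewrite ncV nc_real normr_nat invf_le1 // ler1n.
rewrite !ncM ncX; apply: (@le_trans _ _ (K * 1 * 1)); last by rewrite !mulr1.
rewrite ler_pM ?mulr_ge0 ?exprn_ge0 ?nc_ge0 // ler_pM ?exprn_ge0 ?nc_ge0 //.
  by apply: mK; [rewrite ltnS ltnW // ltnS | exact: nc_real_mul_le1].
by rewrite exprn_ile1 ?nc_ge0.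
Qed.
End MomentFlow.

(** * Moments of measures whose potentials satisfy the equation *)
Section Measures.
Variable R : realType.
Local Notation C := (Cplx R).
Local Notation Re := (@complex.Re R).
Local Notation Im := (@complex.Im R).
Local Notation nc := (@Normc.normc R).
Local Notation E3 := ((R * R) * R)%type.
Local Notation E4 := ((R * R) * (R * R))%type.

Variable mu : C -> probability (Cborel R) R.
Variables (U : set C) (r : R).
Hypothesis supp : forall tau, U tau -> compactly_supported (mu tau).
Hypothesis pde : forall z tau : C, r < nc z -> U tau -> potential_pde mu z tau.
Variables (tau0 : C) (e1 : R).
Hypothesis e10 : 0 < e1.
Hypothesis boxU : forall h : C, `|Re h| <= e1 -> `|Im h| <= e1 -> U (tau0 + h).

Local Notation S z tau := (fine (log_potential (mu tau) z)).

(** On the compact set of real [z] between [c] and [c + 1] and [tau] in a box around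
    [tau0], [S] is continuous, hence bounded; for each [tau] one of these [z] is a
    point near which [mu tau] does not concentrate. *)
Lemma potential_growth : exists K : R, forall z h : C,
  `|Re h| <= e1 -> `|Im h| <= e1 -> r < nc z -> S z (tau0 + h) <= K + 2 * nc z.
Proof.
pose c : R := `|r| + 1.
have cr : r < c by rewrite /c; have := ler_norm r; lra.
have c1 : 1 <= c by rewrite /c lerDr.
pose Kset : set E4 := (`[c, c + 1]%classic `*` `[0, 0]%classic) `*`
  (`[Re tau0 - e1, Re tau0 + e1]%classic `*` `[Im tau0 - e1, Im tau0 + e1]%classic).
have cK : compact Kset by apply: compact_setX; apply: compact_setX; exact: segment_compact.
have [q qK qmax] : exists2 q, q \in Kset & forall t, t \in Kset ->
    potential_coord mu t <= potential_coord mu q.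
  apply: compact_EVT_max => //.
    have e1' := ltW e10.
    exists ((c, 0), (Re tau0, Im tau0)); split; split; rewrite /= in_itv /=;
      apply/andP; by split; rewrite ?lerBlDr ?lerDl ?lexx.
  apply: continuous_in_subspaceT => -[[x y] [t1 t2]] /set_mem [[/= + +] [/= + +]].
  rewrite !in_itv /= => /andP[xc _] /andP[y0 y0'] /andP[? ?] /andP[? ?].
  have yE : y = 0 by lra.
  apply: differentiable_continuous.
  have hU : U (t1 +i* t2)%C.
    have -> : (t1 +i* t2)%C = tau0 + ((t1 - Re tau0) +i* (t2 - Im tau0))%C :> C.
      by apply: C_eq; rewrite ?CReD ?CImD /=; ring.
    by apply: boxU; rewrite /= ler_norml; apply/andP; split; lra.
  have hz : r < nc (x +i* y)%C.
    by rewrite yE -/(x%:C%C) nc_real ger0_norm; lra.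
  by have [_ ] := pde hz hU.
pose K := potential_coord mu q.
exists (K + 10 + 2 * (c + 1)) => z h hr hi rz.
have hU := boxU hr hi.
have [t /andP[tc tc1] prox] := exists_not_concentrated (mu (tau0 + h)) (@measurable_Re R) c.
have rt : r < nc (t%:C%C : C) by rewrite nc_real ger0_norm; lra.
have [ft _ _] := pde rt hU.
have [fz _ _] := pde rz hU.
have tK : S (t%:C%C : C) (tau0 + h) <= K.
  have := qmax ((t, 0), (Re (tau0 + h), Im (tau0 + h))); rewrite /potential_coord /=.
  rewrite -C_eta; apply; rewrite inE; split; split; rewrite /= in_itv /=.
  - by rewrite tc tc1.
  - by rewrite lexx.
  - by rewrite CReD lerD2l lerD2l -ler_norml.
  - by rewrite CImD lerD2l lerD2l -ler_norml.
apply: le_trans (log_potential_growth prox ft tK fz) _.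
have l1 : ln (1 + nc (z - t%:C%C)) <= nc (z - t%:C%C).
  by apply: le_ln1Dx; rewrite (lt_le_trans _ (nc_ge0 _)) // ltrN10.
have tn : `|t| = t by rewrite ger0_norm //; lra.
have := ncD z (- t%:C%C); rewrite ncN nc_real tn.
move=> w1; lra.
Qed.

Lemma barrier_dominates (f p A X delta N w s : R) : 0 <= s -> 0 <= w ->
  f <= p + w -> w <= A * X + delta * N -> f <= p + (1 + s) * (A * X + delta * N).
Proof.
move=> s0 w0 fw wb; apply: (le_trans fw); rewrite lerD2l.
by apply: (le_trans wb); rewrite ler_peMl ?lerDl //; exact: le_trans wb.
Qed.

(** The far circle [|z| = y] is chosen so that [delta y^2] exceeds the linear
    growth of the potential and the lower bound [- D] of the profile; the summand
    [x] keeps a given point inside. *)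
Lemma barrier_far (f p K D delta x y N : R) : 0 <= D -> 0 < delta -> 0 <= x ->
  y = 1 + x + (`|K| + 2 + D) / delta -> N = y ^+ 2 ->
  f <= K + 2 * y -> - D <= p -> f <= p + delta * N.
Proof.
move=> D0 d0 x0 yE -> fK Dp.
have q0 : 0 <= (`|K| + 2 + D) / delta by rewrite divr_ge0 ?addr_ge0 // ltW.
have dq : delta * ((`|K| + 2 + D) / delta) = `|K| + 2 + D by field; rewrite gt_eqF.
have y1 : 1 <= y by lra.
have dy : `|K| + 2 + D <= delta * y.
  rewrite yE mulrDr dq lerDr mulr_ge0 ?(ltW d0) //; lra.
have : (`|K| + 2 + D) * y <= delta * y * y by rewrite ler_wpM2r //; lra.
have h3 : (`|K| + D) <= (`|K| + D) * y by rewrite ler_peMr // addr_ge0.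
have := ler_norm K; rewrite expr2 mulrA; lra.
Qed.

(** For fixed [delta], compares [S] with the barrier on an annulus whose outer
    radius depends on [delta], then lets [delta] tend to [0]. The factor [2] is
    the value of [1 + s] at [s = 1]. *)
Lemma flow_upper_bound (m : nat -> {poly C}) (a : nat) (h : C) (K K0 r0 D A rho : R) :
  (forall x, (m 0).[x] = 1) ->
  (forall b, (m b).[0] = holo_moment (mu tau0) b) ->
  nc h <= 1 -> `|Re h| <= e1 -> `|Im h| <= e1 ->
  0 <= K0 -> K0 <= A -> 0 <= D -> 1 <= rho -> r < rho -> r0 <= rho ->
  0 <= K + 2 * rho + D <= A * (rho ^+ 2)^-1 ^+ a.+1 ->
  (forall z h : C, `|Re h| <= e1 -> `|Im h| <= e1 -> r < nc z ->
     S z (tau0 + h) <= K + 2 * nc z) ->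
  (forall z : C, r0 <= nc z -> `|S z tau0 - (ln (nc z ^+ 2) - 2 * Re (\sum_(b < a.*2.+1)
     holo_moment (mu tau0) b.+1 * z^-1 ^+ b.+1 / b.+1%:R))| <= K0 * (nc z)^-1 ^+ a.*2.+2) ->
  (forall q : E3, 1 <= nc (zc q.1) -> 0 <= q.2 <= 1 -> - D <= profile m a h q) ->
  (forall (delta : R) (q : E3), 0 < delta <= 1 -> 1 <= nc (zc q.1) -> 0 <= q.2 <= 1 ->
     Re (barrier_z m a A delta h q ^+ 2 * h) < barrier_t m a A delta h q) ->
  forall z, rho <= nc z -> S z (tau0 + h) <= profile m a h ((Re z, Im z), 1)
      + 2 * (A * (nc z ^+ 2)^-1 ^+ a.+1).
Proof.
move=> m0 mM h1 hRe hIm K00 K0A D0 rho1 rhor rhor0 /andP[B0 BA] growth exp0 prof super z rz.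
have A0 : 0 <= A by apply: le_trans K0A.
have seg (s : R) : 0 <= s <= 1 -> `|Re (s%:C%C * h)| <= e1 /\ `|Im (s%:C%C * h)| <= e1.
  move=> /andP[s0 s1]; rewrite CReMr CImMr !normrM (ger0_norm s0).
  split; [apply: le_trans hRe | apply: le_trans hIm]; by rewrite ler_piMl.
pose F (q : E3) := potential_coord mu
   (q.1, (Re tau0 + q.2 * Re h, Im tau0 + q.2 * Im h)).
have FE (q : E3) : F q = S (zc q.1) (tau0 + (q.2)%:C%C * h).
  rewrite /F /potential_coord /= /zc; congr (fine (log_potential (mu _) _)).
  by apply: C_eq; rewrite ?CReD ?CImD ?CReMr ?CImMr.
have nz1 : 1 <= nc z := le_trans rho1 rz.
have nz0 : 0 < nc z := lt_le_trans ltr01 nz1.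
suff main (delta : R) : 0 < delta <= 1 -> S z (tau0 + h) <=
    profile m a h ((Re z, Im z), 1) + 2 * (A * (nc z ^+ 2)^-1 ^+ a.+1 + delta * nc z ^+ 2).
  rewrite leNgt; apply/negP; set x := profile _ _ _ _ + _; set y := S _ _ => xy.
  pose N := nc z ^+ 2; have N0 : 0 < N by rewrite exprn_gt0.
  (* With y - x the excess, 2 * delta * N is at most half of it. *)
  pose delta := Num.min 1 ((y - x) / (4 * N)).
  have d0 : 0 < delta by rewrite lt_min ltr01 divr_gt0 ?subr_gt0 // mulr_gt0.
  have d1 : delta <= 1 by rewrite ge_min lexx.
  have := main delta; rewrite d0 d1 => /(_ isT); rewrite -/N mulrDr addrA -/x -/y.
  have : delta <= (y - x) / (4 * N) by rewrite ge_min lexx orbT.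
  rewrite ler_pdivlMr ?mulr_gt0 //.
  move=> ? ?; lra.
move=> d01; have /andP[d0 d1] := d01.
pose rho2 := 1 + nc z + (`|K| + 2 + D) / delta.
have q0 : 0 <= (`|K| + 2 + D) / delta by rewrite divr_ge0 ?addr_ge0 // ltW.
have rho2z : nc z <= rho2.
  by rewrite /rho2 -addrA [1 + _]addrC -addrA lerDl addr_ge0.
have z0E : zc (Re z, Im z) = z by rewrite [RHS]C_eta.
have cmp : F ((Re z, Im z), 1) <= barrier m a A delta h ((Re z, Im z), 1).
  apply: (@comparison _ rho rho2 h F (barrier m a A delta h) (barrier_z m a A delta h)
    (barrier_t m a A delta h)); last first.
  - by split; rewrite ?z0E ?rz ?rho2z //= lexx ler01.
  - move=> q [/andP[rq _] s01] bd.
    have q1 : 1 <= nc (zc q.1) := le_trans rho1 rq.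
    have [s0 s1] := andP s01; have [hr hi] := seg _ s01.
    have fin : F q <= K + 2 * nc (zc q.1).
      by rewrite FE; apply: growth => //; apply: lt_le_trans rq.
    have prq := prof q q1 s01.
    rewrite /barrier; set N := nc (zc q.1) ^+ 2.
    have N0 : 0 <= N by rewrite sqr_ge0.
    have X0 : 0 <= N^-1 ^+ a.+1 by rewrite exprn_ge0 // invr_ge0.
    have dN0 : 0 <= delta * N by rewrite mulr_ge0 // ltW.
    have AX0 : 0 <= A * N^-1 ^+ a.+1 by rewrite mulr_ge0.
    case: bd => [q20|[qrho|qrho2]].
    + apply: (barrier_dominates s0 (w := K0 * N^-1 ^+ a.+1)).
      * by rewrite mulr_ge0.
      * have -> : F q = S (zc q.1) tau0 by rewrite FE q20 mul0r addr0.
        have := exp0 (zc q.1) (le_trans rhor0 rq); rewrite ler_norml => /andP[_].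
        have -> : K0 * (nc (zc q.1))^-1 ^+ a.*2.+2 = K0 * N^-1 ^+ a.+1.
          by rewrite /N -exprVn -exprM mul2n.
        rewrite /profile q20.
        under [in X in _ -> _ <= X + _]eq_bigr do rewrite mul0r mM.
        by rewrite lerBlDl.
      * by apply: ler_wpDr => //; rewrite ler_wpM2r.
    + apply: (barrier_dominates s0 B0).
        by move: fin prq; rewrite qrho => ? ?; lra.
      by apply: ler_wpDr => //; rewrite /N qrho.
    + apply: (barrier_dominates s0 dN0); last by rewrite lerDr.
      apply: (barrier_far D0 d0 (nc_ge0 z) _ _ fin prq); last by [].
      exact: qrho2.
  - move=> q [/andP[rq _] s01]; apply: super => //; exact: le_trans rq.
  - move=> q [/andP[rq _] s01] v; apply: (rdiff_barrier m0).
    by rewrite -nc_gt0 (lt_le_trans _ rq) // (lt_le_trans ltr01).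
  move=> q [/andP[rq _] s01]; apply: rdiff_along.
  have [hr hi] := seg _ s01.
  by apply: pde; [exact: lt_le_trans rq | apply: boxU].
move: cmp; rewrite FE z0E mul1r /barrier z0E.
by [].
Qed.

(** The upper bound by the profile, subtracted from the expansion of the
    potential at [tau0 + h] itself, is a one-sided bound on an expansion in [1/z]
    whose coefficients are the differences of moments. *)
Lemma moment_flow_local (m : nat -> {poly C}) (a : nat) :
  (forall x, (m 0).[x] = 1) ->
  (forall a, (m a)^`() =
      - (a%:R / 2%:R) *: \sum_(0 <= b < a.-1) m b * m (a - b - 2)%N) ->
  (forall b, (m b).[0] = holo_moment (mu tau0) b) ->
  exists2 e : R, 0 < e & forall h : C, nc h < e ->
    forall b, (b < a.*2.+1)%N -> holo_moment (mu (tau0 + h)) b.+1 = (m b.+1).[h].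
Proof.
move=> m0 dm mM; pose n := a.*2.+1.
have U0 : U tau0 by rewrite -[tau0]addr0; apply: boxU; rewrite normr0 ltW.
have [K growth] := potential_growth.
have [r0 [K0 [r00 K00 exp0]]] := log_potential_expansion n (supp U0).
have [D D0 prof] := profile_ge m a.
have [C0 [C1 [C00 C10 super]]] := barrier_supersolution dm a.
have [rho [rho1 rhor rhor0]] : exists rho : R, [/\ 1 <= rho, r < rho & r0 <= rho].
  exists (1 + `|r| + r0); have := normr_ge0 r; have := ler_norm r; move=> ? ?; split; lra.
have [K' [K'K K'0]] : exists K' : R, K <= K' /\ 0 <= K' by exists `|K|; rewrite ler_norm.
have growth' (z h : C) : `|Re h| <= e1 -> `|Im h| <= e1 -> r < nc z ->
    S z (tau0 + h) <= K' + 2 * nc z.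
  by move=> ? ? ?; apply: (le_trans (growth z h _ _ _)) => //; rewrite lerD2r.
pose B := K' + 2 * rho + D.
have B0 : 0 <= B by rewrite /B !addr_ge0 // mulr_ge0 // (le_trans ler01).
have rhoN : 0 < (rho ^+ 2) ^+ a.+1 by rewrite !exprn_gt0 // (lt_le_trans ltr01).
have Brho : 0 <= B * (rho ^+ 2) ^+ a.+1 by rewrite mulr_ge0 // ltW.
have [A [A1 AK0 AB]] : exists A : R, [/\ 1 <= A, K0 <= A & B <= A * (rho ^+ 2)^-1 ^+ a.+1].
  exists (1 + K0 + B * (rho ^+ 2) ^+ a.+1); split; [lra | lra |].
  by rewrite exprVn ler_pdivlMr //; lra.
(* |h| L < 1 is the smallness required of the barrier, and L >= 8 gives |h| <= 1. *)
have [L [L8 LE]] : exists L : R, 8 <= L /\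
    L = C0 + 4 * C1 * (a.+1%:R + 1) + 8 * (a.+1%:R ^+ 2 * A + 1).
  eexists; split; last reflexivity.
  have h1 : 0 <= C1 * (a.+1%:R + 1) by rewrite mulr_ge0 // addr_ge0.
  have h2 : 0 <= a.+1%:R ^+ 2 * A by rewrite mulr_ge0 ?sqr_ge0 // (le_trans ler01).
  by lra.
have L0 : 0 < L by apply: lt_le_trans L8.
exists (Num.min e1 L^-1); first by rewrite lt_min e10 invr_gt0.
move=> h; rewrite lt_min => /andP[he1 heL].
have hL : nc h * L < 1 by rewrite -ltr_pdivlMr // div1r.
have h1 : nc h <= 1.
  by apply: (le_trans (ltW heL)); rewrite invf_le1 // (le_trans _ L8) // ler1n.
have hRe : `|Re h| <= e1 by apply: le_trans (normr_Re_le h) (ltW he1).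
have hIm : `|Im h| <= e1 by apply: le_trans (normr_Im_le h) (ltW he1).
have upper : forall z, rho <= nc z -> S z (tau0 + h) <=
    profile m a h ((Re z, Im z), 1) + 2 * (A * (nc z ^+ 2)^-1 ^+ a.+1).
  apply: (flow_upper_bound m0 mM h1 hRe hIm K00 AK0 D0 rho1 rhor rhor0 _ growth' exp0).
  - by rewrite B0.
  - by move=> q; apply: prof.
  - by move=> delta q d01 q1 s01; apply: super => //; rewrite -LE.
have Uh : U (tau0 + h) by apply: boxU.
have [r0' [K0' [r00' K00' exph]]] := log_potential_expansion n (supp Uh).
pose d (b : nat) : C := (m b.+1).[h] - holo_moment (mu (tau0 + h)) b.+1.
have ez := @expansion_coef_eq0 R n (fun b => d b / b.+1%:R) (A + K0') (Num.max rho r0').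
move=> b bn; apply/eqP; rewrite eq_sym -subr_eq0 -/(d b).
suff db : d b / b.+1%:R = 0.
  by move/eqP: db; rewrite mulf_eq0 invr_eq0 pnatr_eq0 orbF.
apply: ez bn => z; rewrite ge_max => /andP[zr zr'].
have up := upper z zr; have := exph z zr'; rewrite ler_norml => /andP[lo _].
have z0E : zc (Re z, Im z) = z by rewrite [RHS]C_eta.
have sumE : Re (\sum_(b < n) d b / b.+1%:R * z^-1 ^+ b.+1) =
  Re (\sum_(b < n) (m b.+1).[h] * z^-1 ^+ b.+1 / b.+1%:R)
  - Re (\sum_(b < n) holo_moment (mu (tau0 + h)) b.+1 * z^-1 ^+ b.+1 / b.+1%:R).
  rewrite -CReN -CReD -sumrN -big_split /=; congr Re; apply: eq_bigr => i _.
  by rewrite /d; ring.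
have nE : (nc z ^+ 2)^-1 ^+ a.+1 = (nc z)^-1 ^+ n.+1 by rewrite -exprVn -exprM mul2n.
move: up lo; rewrite /profile z0E nE.
under [in X in _ <= _ - X + _ -> _]eq_bigr do rewrite mul1r.
rewrite sumE; have y0 : 0 <= (nc z)^-1 ^+ n.+1 by rewrite exprn_ge0 // invr_ge0 nc_ge0.
have := mulr_ge0 K00' y0.
move: (Re _) (Re _) (S _ _) ((nc z)^-1 ^+ n.+1) (ln _) => u v w y l.
move=> ? ? ?; lra.
Qed.
End Measures.

Lemma holo_moment0 (R : realType) (mu : probability (Cborel R) R) : holo_moment mu 0 = 1.
Proof.
have cE (c : R) : \int[mu]_w c = c.
  rewrite Rintegral_cst // (_ : fine _ = 1) ?mulr1 //.
  exact: (congr1 fine (probability_setT mu)).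
by rewrite /holo_moment; apply: C_eq; rewrite /= cE.
Qed.

(** Near [tau] the moments coincide with the polynomials that solve the
    hierarchy, translated by [tau]. *)
Lemma is_derive_holo_moment (R : realType) (mu : Cplx R -> probability (Cborel R) R)
    (U : set (Cplx R)) : open U ->
  (forall tau : Cplx R, U tau -> compactly_supported (mu tau)) ->
  (exists r : R, forall z tau : Cplx R,
    r < Normc.normc z -> U tau -> potential_pde mu z tau) ->
  forall (a : nat) (tau : Cplx R), U tau ->
    is_derive tau 1 (fun t => holo_moment (mu t) a)
      (- (a%:R / 2%:R) *
       \sum_(0 <= b < a.-1)
         holo_moment (mu tau) b * holo_moment (mu tau) (a - b - 2)).
Proof.
move=> openU supp [r pde] a tau Utau.
have [e0 e00 ball] : exists2 e : R, 0 < e & forall w, Normc.normc (tau - w) < e -> U w.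
  by apply/nc_ballP; apply: open_nbhs_nbhs; split.
pose e1 := e0 / 3.
have e10 : 0 < e1 by rewrite divr_gt0.
have boxU (h : Cplx R) : `|complex.Re h| <= e1 -> `|complex.Im h| <= e1 -> U (tau + h).
  move=> hr hi; apply: ball; rewrite opprD addNKr ncN.
  by apply: (le_lt_trans (nc_le_ReIm h)); move: hr hi; rewrite /e1; lra.
have [m [mM dm]] := moment_flow_exists (holo_moment (mu tau)).
have m0 x : (m 0).[x] = 1.
  rewrite deriv0_horner ?mM ?holo_moment0 //.
  by rewrite dm big_geq // scaler0.
have [e e_gt0 flow] := moment_flow_local supp pde e10 boxU a m0 dm mM.
pose p : {poly Cplx R} := m a \Po ('X - tau%:P).
have pE t : p.[t] = (m a).[t - tau] by rewrite horner_comp !hornerE.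
apply: (@near_eq_is_derive _ _ _ (horner p)).
- apply/nc_ballP; exists e => // w we; rewrite pE.
  have := flow (w - tau); rewrite -ncN opprB => /(_ we); rewrite addrC subrK.
  case: a {flow p pE} => [|a] flow; first by rewrite m0 holo_moment0.
  by rewrite flow // ltnS -addnn; apply: leq_trans (leq_addr _ _).
- apply: is_derive_eq; first exact: is_derive_horner.
  rewrite deriv_comp derivB derivX derivC subr0 mulr1 horner_comp !hornerE subrr.
  rewrite dm hornerZ horner_sum; congr (_ * _).
  by apply: eq_bigr => b _; rewrite hornerM !mM.
Qed.

Unset Implicit Arguments.

Theorem theorem5p1 (R : realType) :
  (forall (N : nat) (p : {poly Cplx R}), (0 < N)%N -> size p = N.+1 ->
    forall tau : Cplx R,
      is_derive tau 1 (root_moment p N 0) 0 /\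
      is_derive tau 1 (root_moment p N 1) 0 /\
      forall a : nat, (2 <= a)%N ->
        is_derive tau 1 (root_moment p N a)
          ((2%:R * N%:R)^-1 * a%:R * (a%:R - 1) * root_moment p N (a - 2) tau
           - a%:R / 2%:R *
             \sum_(0 <= b < a.-1)
               root_moment p N b tau * root_moment p N (a - b - 2) tau))
  /\
  (forall p : nat -> {poly Cplx R},
    (forall N : nat, (0 < N)%N -> size (p N) = N.+1) ->
    (forall a : nat, cvgn (fun N => root_moment (p N) N a 0)) ->
    forall (a : nat) (tau : Cplx R),
      cvgn (fun N => root_moment (p N) N a tau) /\
      is_derive tau 1 (limit_root_moment p a)
        (- (a%:R / 2%:R) *
         \sum_(0 <= b < a.-1)
           limit_root_moment p b tau * limit_root_moment p (a - b - 2) tau))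
  /\
  (forall (mu : Cplx R -> probability (Cborel R) R) (U : set (Cplx R)),
    open U ->
    (forall tau : Cplx R, U tau -> compactly_supported (mu tau)) ->
    (exists r : R, forall z tau : Cplx R,
      r < Normc.normc z -> U tau -> potential_pde mu z tau) ->
    forall (a : nat) (tau : Cplx R), U tau ->
      is_derive tau 1 (fun t => holo_moment (mu t) a)
        (- (a%:R / 2%:R) *
         \sum_(0 <= b < a.-1)
           holo_moment (mu tau) b * holo_moment (mu tau) (a - b - 2))).
Proof.
split; last by split; [exact: is_derive_limit_root_moment | exact: is_derive_holo_moment].
move=> N p N0 sp tau; split; [|split => [|a _]]; last exact: is_derive_root_moment.
- apply: is_derive_eq; first exact: is_derive_root_moment N0 sp.
  by rewrite !(mulr0, mul0r) subrr.
- apply: is_derive_eq; first exact: is_derive_root_moment N0 sp.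
  by rewrite subrr big_nil !(mulr0, mul0r) subrr.
Qed.
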